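(* For each of the correlation kernels listed in the context, consider the decomposition $\boldsymbol\Sigma_\theta=\boldsymbol 1\boldsymbol 1^\top+g_0(\theta)\boldsymbol D^{(q)}+\boldsymbol R_0(\theta)$ of the correlation matrix, with $\lim_{\theta\to+\infty}\|\frac1{g_0(\theta)}\boldsymbol R_0(\theta)\|=0$, where $g_0$ and $q$ are those given for the kernel in the context. In this decomposition: - if the correlation kernel is Spherical, Power Exponential with $\rho<2$ or Matérn with $\nu<1$, then $q<1$ and $\boldsymbol D^{(q)}$ is nonsingular; - if the correlation kernel is Squared Exponential (i.e. Power Exponential with $\rho=2$), Rational Quadratic or Matérn with $\nu\ge1$, then $q=1$; - if $n>r+2$ and the correlation kernel is Squared Exponential, Rational Quadratic or Matérn with $\nu\ge1$, then $\boldsymbol D^{(q)}=\boldsymbol D^{(1)}$ is singular.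
   Context: Let $n$ and $r$ be positive integers and let $\boldsymbol x^{(1)},\dots,\boldsymbol x^{(n)}$ be $n$ distinct fixed points in a domain of $\mathbb R^r$. For a kernel $K$ with $K(0)=1$ and $\theta\in(0,+\infty)$, $K_\theta(t)=K(t/\theta)$, and $\boldsymbol\Sigma_\theta$ is the $n\times n$ matrix with $(i,i')$-th element $K_\theta(\|\boldsymbol x^{(i)}-\boldsymbol x^{(i')}\|)$. $\boldsymbol 1\in\mathbb R^n$ is the vector of ones; $\boldsymbol D^{(q)}$ is the $n\times n$ matrix with $(i,i')$-th element $\|\boldsymbol x^{(i)}-\boldsymbol x^{(i')}\|^{2q}$; $g_0$ is a real-valued function; $\boldsymbol R_0$ is a function from $(0,+\infty)$ to the set of real $n\times n$ matrices; $\|\cdot\|$ is the Euclidean norm on vectors and the Frobenius norm on matrices. Kernels with the associated $g_0$ and $q$ ($t>0$): - Spherical (used only if $r\in\{1,2,3\}$): $K(t)=(1-\frac32t+\frac12t^3)\boldsymbol 1_{\{t\le1\}}$ (here $\boldsymbol 1_{\{\cdot\}}$ denotes an indicator); $g_0(\theta)=-\frac32\theta^{-1}$, $q=1/2$. - Power Exponential, $\rho\in(0,2]$: $K(t)=\exp(-t^\rho)$; $g_0(\theta)=-\theta^{-\rho}$, $q=\rho/2$. - Rational Quadratic, $\nu\in(0,+\infty)$: $K(t)=(1+t^2)^{-\nu}$; $g_0(\theta)=-\nu\theta^{-2}$, $q=1$. - Matérn, $\nu\in(0,+\infty)$: $K(t)=\Gamma(\nu)^{-1}2^{1-\nu}(2\sqrt\nu\,t)^\nu\mathcal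 K_\nu(2\sqrt\nu\,t)$ with $\mathcal K_\nu$ the modified Bessel function of the second kind with parameter $\nu$; if $\nu<1$: $g_0(\theta)=\Gamma(-\nu)\nu^\nu\Gamma(\nu)^{-1}\theta^{-2\nu}$, $q=\nu$; if $\nu=1$: $g_0(\theta)=-2\theta^{-2}\log(\theta)$, $q=1$; if $\nu>1$: $g_0(\theta)=-\nu(\nu-1)^{-1}\theta^{-2}$, $q=1$.
   Formalization: The nonsingularity of D^(q) in the first bullet is stated only for n ≥ 2, since for n = 1 the matrix D^(q) is the 1×1 zero matrix and hence singular; everything else is stated for all n ≥ 1. *)

(* Defs.v *)
From HB Require Import structures.
From mathcomp Require Import all_boot all_order all_algebra.
From mathcomp Require Import all_classical all_reals all_analysis.

Set Implicit Arguments.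
Unset Strict Implicit.
Unset Printing Implicit Defensive.

Import Order.TTheory GRing.Theory Num.Theory.
Import numFieldNormedType.Exports.

Local Open Scope classical_set_scope.
Local Open Scope ring_scope.

(* The library norm on matrices is the sup norm, hence the two norms below. *)
Definition euclid_norm (R : realType) (r : nat) (v : 'rV[R]_r) : R :=
  Num.sqrt (\sum_(j < r) v 0 j ^+ 2).

Definition frobenius_norm (R : realType) (m n : nat) (M : 'M[R]_(m, n)) : R :=
  Num.sqrt (\sum_(i < m) \sum_(j < n) M i j ^+ 2).

(* Euler's integral, meaningful for 0 < x. *)
Definition euler_integral (R : realType) (x : R) : R :=
  \int[lebesgue_measure]_(t in `]0, +oo[) (t `^ (x - 1) * expR (- t)).

(* Gamma on the real line minus {0, -1, -2, ...}: with m the least natural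
   number such that 0 < x + m,
   Gamma x = Gamma (x + m) / (x (x + 1) ... (x + m - 1)). *)
Definition Gamma (R : realType) (x : R) : R :=
  let m := if 0 < x then 0%N else (Num.truncn (- x)).+1 in
  euler_integral (x + m%:R) / \prod_(k < m) (x + k%:R).

Definition cosh (R : realType) (x : R) : R := (expR x + expR (- x)) / 2.

(* Modified Bessel function of the second kind, real order nu, argument z > 0:
   K_nu(z) = int_0^oo exp (- z cosh t) cosh (nu t) dt. *)
Definition besselK (R : realType) (nu z : R) : R :=
  \int[lebesgue_measure]_(t in `[0, +oo[) (expR (- z * cosh t) * cosh (nu * t)).

Inductive corr_kernel (R : realType) : Type :=
  | Spherical
  | PowerExponential of R
  | RationalQuadratic of R
  | Matern of R.
Arguments Spherical {R}.

Definition kernel_admissible (R : realType) (r : nat) (k : corr_kernel R) : bool :=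
  match k with
  | Spherical => r \in [:: 1; 2; 3]%N
  | PowerExponential rho => 0 < rho <= 2
  | RationalQuadratic nu => 0 < nu
  | Matern nu => 0 < nu
  end.

(* Only for t > 0: the Matern formula is indeterminate at t = 0. *)
Definition kernel_pos (R : realType) (k : corr_kernel R) (t : R) : R :=
  match k with
  | Spherical =>
      (1 - 3 / 2 * t + 1 / 2 * t ^+ 3) * (if t <= 1 then 1 else 0)
  | PowerExponential rho => expR (- (t `^ rho))
  | RationalQuadratic nu => (1 + t ^+ 2) `^ (- nu)
  | Matern nu =>
      (Gamma nu)^-1 * 2 `^ (1 - nu) * (2 * Num.sqrt nu * t) `^ nu
        * besselK nu (2 * Num.sqrt nu * t)
  end.

Definition kernel_fun (R : realType) (k : corr_kernel R) (t : R) : R :=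
  if t == 0 then 1 else kernel_pos k t.

Definition g0 (R : realType) (k : corr_kernel R) (theta : R) : R :=
  match k with
  | Spherical => - (3 / 2) * theta^-1
  | PowerExponential rho => - (theta `^ (- rho))
  | RationalQuadratic nu => - nu * theta ^- 2
  | Matern nu =>
      if nu < 1 then
        Gamma (- nu) * nu `^ nu * (Gamma nu)^-1 * theta `^ (- (2 * nu))
      else if nu == 1 then - 2 * theta ^- 2 * ln theta
      else - nu * (nu - 1)^-1 * theta ^- 2
  end.

Definition qexp (R : realType) (k : corr_kernel R) : R :=
  match k with
  | Spherical => 1 / 2
  | PowerExponential rho => rho / 2
  | RationalQuadratic _ => 1
  | Matern nu => if nu < 1 then nu else 1
  end.

Definition corr_matrix (R : realType) (n r : nat) (x : 'I_n -> 'rV[R]_r)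
    (k : corr_kernel R) (theta : R) : 'M[R]_n :=
  \matrix_(i, j) kernel_fun k (euclid_norm (x i - x j) / theta).

Definition ones (R : realType) (n : nat) : 'cV[R]_n := const_mx 1.
Arguments ones : clear implicits.

Definition dist_matrix (R : realType) (n r : nat) (x : 'I_n -> 'rV[R]_r)
    (q : R) : 'M[R]_n :=
  \matrix_(i, j) (euclid_norm (x i - x j)) `^ (2 * q).

Definition rough_kernel (R : realType) (k : corr_kernel R) : bool :=
  match k with
  | Spherical => true
  | PowerExponential rho => rho < 2
  | RationalQuadratic _ => false
  | Matern nu => nu < 1
  end.

(* rho = 2 is the Squared Exponential kernel. *)
Definition smooth_kernel (R : realType) (k : corr_kernel R) : bool :=
  match k with
  | Spherical => false
  | PowerExponential rho => rho == 2
  | RationalQuadratic _ => true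
  | Matern nu => 1 <= nu
  end.

(* Main.v *)
Require Import Defs.
From HB Require Import structures.
From mathcomp Require Import all_boot all_order all_algebra.
From mathcomp Require Import all_classical all_reals all_analysis.
From mathcomp Require Import measurable_realfun ring lra.

Import Order.TTheory GRing.Theory Num.Theory.
Import numFieldNormedType.Exports.

Local Open Scope classical_set_scope.
Local Open Scope ring_scope.

Set Implicit Arguments.
Unset Strict Implicit.
Unset Printing Implicit Defensive.

(** Two independent facts make the statement true.

    The expansion. For every kernel but the Matern one with nu = 1, the ratio
    (K(t) - 1) / t^(2q) has a finite nonzero limit c as t tends to 0 from the
    right, and g0(theta) = c theta^(-2q); substituting t = d / theta gives
    (K(d / theta) - 1) / g0(theta) --> d^(2q), which says entry by entry that
    R0 / g0 tends to 0 ([kernel_ratio_cvg]). Only the Matern kernels need real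
    work. The substitution s = e^t turns Bessel's and Euler's integrals into
    integrals over the whole line, where Bessel's function becomes
      M(nu, a) = int_0^oo s^(nu-1) e^(-s - a/s) ds,
    so that K(t) = M(nu, nu t^2) / M(nu, 0) ([matern_kernelE]), and it remains
    to find the order at which M(nu, a) - M(nu, 0) vanishes as a --> 0+. The
    scaling s = a s' (for nu < 1), no scaling (for nu > 1), or a stretching of
    the variable t by - ln a (for nu = 1) exhibits a dominated pointwise
    limit; the three limits are [gamma_integral_rough],
    [gamma_integral_smooth] and [gamma_integral_critical].

    The distance matrices. The Gaussian kernel is positive semidefinite
    (expand the exponential of the inner product into powers), and for
    0 < q < 1 the power lam^q is a positive multiple of
      int_0^oo (1 - e^(-lam s)) s^(-q-1) ds.
    Hence, on vectors whose entries sum to 0, the quadratic form of D^(q) is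
    minus an integral of Gaussian quadratic forms; it is strictly negative,
    because for large s the Gaussian matrix of distinct points is close to the
    identity ([sqdist_power_cond_neg]). A symmetric matrix that is negative on
    that hyperplane, has zero diagonal and has a positive entry is
    nonsingular ([cond_neg_def_unitmx]). For q = 1, on the contrary,
    |x - y|^2 = |x|^2 + |y|^2 - 2 <x, y> writes D^(1) as a product through a
    space of dimension r + 2. *)

(** * Quadratic forms and squared distances *)

Lemma quad_formE (R : comNzRingType) (n : nat) (D : 'M[R]_n) (c : 'rV[R]_n) :
  (c *m D *m c^T) 0 0 = \sum_i \sum_j c 0 i * c 0 j * D i j.
Proof.
rewrite mxE exchange_big; apply: eq_bigr => j _ /=.
rewrite !mxE mulr_suml; apply: eq_bigr => i _.
by rewrite mulrAC.
Qed.

(** If c D = 0 with c nonzero, then c is not in the hyperplane of vectors of sum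
    0, hence every vector is a multiple of c plus a vector w of that hyperplane
    and takes on D the same quadratic value as w, which is nonpositive. The sum
    of two basis vectors contradicts this: its value is twice D i0 i1. *)
Lemma cond_neg_def_unitmx (R : realFieldType) (n : nat) (D : 'M[R]_n)
    (i0 i1 : 'I_n) :
  D^T = D -> D i0 i0 = 0 -> D i1 i1 = 0 -> 0 < D i0 i1 ->
  (forall c : 'rV[R]_n, c != 0 -> \sum_j c 0 j = 0 ->
     (c *m D *m c^T) 0 0 < 0) ->
  D \in unitmx.
Proof.
move=> symD D00 D11 D01_gt0 negD; rewrite -row_free_unit.
apply/inj_row_free => c cD0; apply/eqP/negPn/negP => c_neq0.
have DcT0 : D *m c^T = 0 by rewrite -{1}symD -trmx_mul cD0 trmx0.
have [sc0|sc_neq0] := eqVneq (\sum_j c 0 j) 0.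
  by have := negD c c_neq0 sc0; rewrite cD0 mul0mx mxE ltxx.
pose v : 'rV[R]_n := delta_mx 0 i0 + delta_mx 0 i1.
pose w := v - ((\sum_j v 0 j) / (\sum_j c 0 j)) *: c.
have sw0 : \sum_j w 0 j = 0.
  rewrite /w; under eq_bigr do rewrite mxE [in X in _ + X]mxE [in X in - X]mxE.
  by rewrite sumrB -mulr_sumr divfK // subrr.
have wE : w *m D *m w^T = v *m D *m v^T.
  rewrite /w mulmxBl -scalemxAl cD0 scaler0 subr0.
  rewrite linearB linearZ /= mulmxBr -scalemxAr -(mulmxA v D c^T) DcT0 mulmx0.
  by rewrite scaler0 subr0.
have Qv : (v *m D *m v^T) 0 0 = D i0 i1 *+ 2.
  rewrite /v linearD /= mulmxDl mulmxDr !mulmxDl !trmx_delta -!rowE -!colE !mxE.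
  rewrite D00 D11 (_ : D i1 i0 = D i0 i1); first by ring.
  by rewrite -{1}symD mxE.
have Qw_gt0 : 0 < (w *m D *m w^T) 0 0 by rewrite wE Qv pmulrn_lgt0.
have w_neq0 : w != 0.
  by apply: contraTneq Qw_gt0 => ->; rewrite !mul0mx mxE ltxx.
by have := lt_trans Qw_gt0 (negD _ w_neq0 sw0); rewrite ltxx.
Qed.

Lemma mulmx_thin_notin_unitmx (F : fieldType) (m n : nat)
    (A : 'M[F]_(n, m)) (B : 'M[F]_(m, n)) :
  (m < n)%N -> A *m B \notin unitmx.
Proof.
move=> mn; rewrite -row_free_unit /row_free neq_ltn; apply/orP; left.
by apply: leq_ltn_trans (mulmx_max_rank A B) mn.
Qed.

Definition sqdist (R : realType) (r : nat) (u v : 'rV[R]_r) : R :=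
  \sum_j (u - v) 0 j ^+ 2.

Lemma sqdist_ge0 (R : realType) (r : nat) (u v : 'rV[R]_r) : 0 <= sqdist u v.
Proof. by apply: sumr_ge0 => j _; exact: sqr_ge0. Qed.

Lemma sqdistxx (R : realType) (r : nat) (u : 'rV[R]_r) : sqdist u u = 0.
Proof. by rewrite /sqdist big1 // => j _; rewrite subrr mxE expr0n. Qed.

Lemma sqdistC (R : realType) (r : nat) (u v : 'rV[R]_r) :
  sqdist u v = sqdist v u.
Proof.
by apply: eq_bigr => j _; rewrite -(opprB v u) mxE sqrrN.
Qed.

Lemma sqdist_gt0 (R : realType) (r : nat) (u v : 'rV[R]_r) :
  u != v -> 0 < sqdist u v.
Proof.
move=> uv; rewrite lt_neqAle sqdist_ge0 andbT eq_sym.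
apply: contra uv => /eqP.
move=> d0; rewrite -subr_eq0; apply/eqP/rowP => j; rewrite [RHS]mxE.
by apply/eqP; rewrite -sqrf_eq0 (psumr_eq0P _ d0)// => i _; exact: sqr_ge0.
Qed.

Lemma sqdistE (R : realType) (r : nat) (u v : 'rV[R]_r) :
  sqdist u v = (u *m u^T) 0 0 + (v *m v^T) 0 0 - 2 * (u *m v^T) 0 0.
Proof.
rewrite !mxE mulr_sumr -big_split /= -sumrB; apply: eq_bigr => j _.
by rewrite !mxE; ring.
Qed.

(** The rank is at most r + 2, by |x|^2 + |y|^2 - 2 <x, y>. *)
Lemma sqdist_matrix_notin_unitmx (R : realType) (n r : nat)
    (x : 'I_n -> 'rV[R]_r) :
  (r + 2 < n)%N -> (\matrix_(i, j) sqdist (x i) (x j)) \notin unitmx.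
Proof.
move=> rn.
pose X : 'M[R]_(n, r) := \matrix_i x i.
pose N : 'cV[R]_n := \col_i (x i *m (x i)^T) 0 0.
pose e : 'cV[R]_n := const_mx 1.
pose A := row_mx (row_mx N e) X.
pose B := col_mx (col_mx e^T N^T) (- 2 *: X^T).
suff -> : \matrix_(i, j) sqdist (x i) (x j) = A *m B.
  by apply: mulmx_thin_notin_unitmx; rewrite addnC.
rewrite /A /B !mul_row_col; apply/matrixP => i j.
rewrite !mxE !big_ord1 !mxE mulr1 mul1r sqdistE.
congr (_ + _); first by rewrite !mxE.
rewrite [in LHS]mxE mulr_sumr -sumrN.
by apply: eq_bigr => k _; rewrite !mxE; ring.
Qed.

(** * The Gaussian kernel is positive semidefinite *)

Section gaussian.
Variables (R : realType) (n r : nat).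
Implicit Types (x : 'I_n -> 'rV[R]_r) (b : 'I_n -> R).

(** One factor <x i, x j> is spread over the coordinates and absorbed into the
    coefficients, which is why the induction is over all b at once. *)
Lemma inner_power_psd x (k : nat) b :
  0 <= \sum_i \sum_j b i * b j * (x i *m (x j)^T) 0 0 ^+ k.
Proof.
elim: k b => [b|k IHk b].
  under eq_bigr do under eq_bigr do rewrite expr0 mulr1.
  under eq_bigr do rewrite -mulr_sumr.
  by rewrite -mulr_suml -expr2 sqr_ge0.
suff -> : \sum_i \sum_j b i * b j * (x i *m (x j)^T) 0 0 ^+ k.+1 =
   \sum_l \sum_i \sum_j
     (b i * x i 0 l) * (b j * x j 0 l) * (x i *m (x j)^T) 0 0 ^+ k.
  by apply: sumr_ge0 => l _; exact: IHk.
rewrite [RHS]exchange_big /=; apply: eq_bigr => i _.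
rewrite [RHS]exchange_big /=; apply: eq_bigr => j _.
rewrite exprS {1}mxE mulr_suml mulr_sumr; apply: eq_bigr => l _.
by rewrite !mxE; ring.
Qed.

Lemma cvg_sum_fin (I : finType) (T : Type) (F : set_system T) (FF : Filter F)
    (f : I -> T -> R) (l : I -> R) :
  (forall i, f i t @[t --> F] --> l i) ->
  \sum_i f i t @[t --> F] --> \sum_i l i.
Proof. by move=> fl; apply: cvg_big => //; exact: add_continuous. Qed.

Lemma exp_inner_psd x (s : R) b :
  0 <= s -> 0 <= \sum_i \sum_j b i * b j * expR (s * (x i *m (x j)^T) 0 0).
Proof.
move=> s0.
pose S m := \sum_i \sum_j b i * b j *
  series (exp_coeff (s * (x i *m (x j)^T) 0 0)) m.
have S_ge0 m : 0 <= S m.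
  suff -> : S m = \sum_(0 <= k < m) s ^+ k / k`!%:R *
     \sum_i \sum_j b i * b j * (x i *m (x j)^T) 0 0 ^+ k.
    apply: sumr_ge0 => k _; rewrite mulr_ge0 ?inner_power_psd //.
    by rewrite divr_ge0 ?exprn_ge0.
  under [RHS]eq_bigr do rewrite mulr_sumr.
  rewrite [RHS]exchange_big /=; apply: eq_bigr => i _.
  under [RHS]eq_bigr do rewrite mulr_sumr.
  rewrite [RHS]exchange_big /=; apply: eq_bigr => j _.
  rewrite /series /= mulr_sumr; apply: eq_bigr => k _.
  by rewrite /exp_coeff /= exprMn; ring.
have cvgS : S @ \oo --> \sum_i \sum_j b i * b j * expR (s * (x i *m (x j)^T) 0 0).
  apply: cvg_sum_fin => i; apply: cvg_sum_fin => j; apply: cvgMr.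
  exact: is_cvg_series_exp_coeff.
rewrite -(cvg_lim _ cvgS) //; apply: limr_ge; last exact: nearW.
by apply/cvg_ex; eexists; exact: cvgS.
Qed.

(** |x - y|^2 = |x|^2 + |y|^2 - 2 <x, y>, and the first two terms only rescale
    the coefficients. *)
Lemma gaussian_psd x (s : R) b :
  0 <= s -> 0 <= \sum_i \sum_j b i * b j * expR (- (s * sqdist (x i) (x j))).
Proof.
move=> s0.
suff -> : \sum_i \sum_j b i * b j * expR (- (s * sqdist (x i) (x j))) =
   \sum_i \sum_j (b i * expR (- (s * (x i *m (x i)^T) 0 0))) *
     (b j * expR (- (s * (x j *m (x j)^T) 0 0))) *
     expR ((2 * s) * (x i *m (x j)^T) 0 0).
  apply: (@exp_inner_psd x (2 * s) (fun i => b i * expR (- (s * (x i *m (x i)^T) 0 0)))).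
  by rewrite mulr_ge0.
apply: eq_bigr => i _; apply: eq_bigr => j _.
rewrite mulrACA -!mulrA -!expRD; congr (_ * (_ * expR _)).
by rewrite sqdistE; ring.
Qed.

End gaussian.

(** * Real-valued integrals over the line *)

Section dominated_convergence_real.
Context d (T : measurableType d) (R : realType) (mu : {measure set T -> \bar R}).

Lemma Rdominated_cvg (f_ : nat -> T -> R) (f g : T -> R) :
  (forall n, measurable_fun setT (f_ n)) -> measurable_fun setT f ->
  {ae mu, forall t, f_ n t @[n --> \oo] --> f t} ->
  mu.-integrable setT (EFin \o g) ->
  (forall n t, `|f_ n t| <= g t) ->
  (\int[mu]_t f_ n t)%R @[n --> \oo] --> (\int[mu]_t f t)%R.
Proof.
move=> mf_ mf f_f ig f_g.
have [] := @dominated_convergence _ _ _ mu setT measurableT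
  (fun n => EFin \o f_ n) (EFin \o f) (EFin \o g).
- by move=> n; apply/measurable_EFinP.
- exact/measurable_EFinP.
- apply: filterS f_f => t f_ft _; apply: cvg_EFin; last exact: f_ft.
  exact: nearW.
- exact: ig.
- by apply: aeW => t n _; rewrite lee_fin.
move=> intf _ cvgf.
apply: fine_cvg; rewrite fineK; first exact: cvgf.
exact: integrable_fin_num.
Qed.

Lemma Rdominated_cvg_at_right (f_ : R -> T -> R) (f g : T -> R) :
  (forall a, measurable_fun setT (f_ a)) -> measurable_fun setT f ->
  {ae mu, forall t, f_ a t @[a --> 0^'+] --> f t} ->
  mu.-integrable setT (EFin \o g) ->
  (\forall a \near 0^'+, forall t, `|f_ a t| <= g t) ->
  (\int[mu]_t f_ a t)%R @[a --> 0^'+] --> (\int[mu]_t f t)%R.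
Proof.
move=> mf_ mf f_f ig f_g.
apply/cvg_at_rightP => u [u_gt0 u0].
have u0' : u n @[n --> \oo] --> 0^'+.
  move=> P; rewrite /at_right /within /= => nP.
  have H : \forall n \near \oo, 0 < u n -> P (u n) := u0 _ nP.
  by apply: filterS H => n; apply; exact: u_gt0.
have [N _ uN] := u0' _ f_g.
rewrite -(cvg_shiftn N) /=.
apply: (@Rdominated_cvg (fun n => f_ (u (n + N)%N)) f g) => //.
  apply: filterS f_f => t f_ft.
  rewrite (cvg_shiftn N (fun n => f_ (u n) t)).
  exact: cvg_comp u0' f_ft.
by move=> n t; apply: uN => /=; rewrite leq_addl.
Qed.

End dominated_convergence_real.

Section real_line_integrals.
Variable R : realType.
Local Notation mu := lebesgue_measure.
Implicit Types (f g F : R -> R).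

Lemma cvg_expR_comp (T : Type) (G : set_system T) (FG : Filter G) (f : T -> R) (l : R) :
  f t @[t --> G] --> l -> expR (f t) @[t --> G] --> expR l.
Proof. by move=> fl; apply: continuous_cvg fl; exact: continuous_expR. Qed.

Lemma sqr_half_le_expR (t : R) : 0 <= t -> t ^+ 2 / 2 <= expR t.
Proof.
move=> t0; apply: le_trans (expR_ge1Dxn 1 t0).
by rewrite (_ : 2`! = 2%N)// ler_wpDl.
Qed.

Lemma is_derive_scale (c x : R) : is_derive x 1 (fun t : R => c * t) c.
Proof.
have d := is_deriveZ c (is_derive_id x (1 : R)).
by apply: is_derive_eq d _; rewrite /GRing.scale /= mulr1.
Qed.

Lemma is_derive_expR_comp (f : R -> R) (x df : R) :
  is_derive x 1 f df -> is_derive x 1 (fun t => expR (f t)) (expR (f x) * df).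
Proof. exact: is_derive1_comp. Qed.

Lemma integrable_exp_decay (C c : R) : 0 < c ->
  mu.-integrable [set: R] (EFin \o (fun t => C * expR (- (c * `|t|)))).
Proof.
move=> c0.
pose h := fun t : R => expR (- (c * `|t|)).
have ch : continuous h.
  by move=> t; apply: cvg_expR_comp; apply: cvgN; apply: cvgMr; exact: cvg_norm.
suff ih : mu.-integrable [set: R] (EFin \o h).
  exact: (integrableZl measurableT C ih).
apply/integrableP; split.
  by apply/measurable_EFinP; exact: continuous_measurable_fun.
rewrite (_ : (fun x => _) = (fun x => (h x)%:E)); last first.
  by apply/funext => t /=; rewrite ger0_norm ?expR_ge0.
rewrite (ge0_symfun_integralT (f := h)) //; last 2 first.
- by move=> t; exact: expR_ge0.
- by move=> t; rewrite /h /= normrN.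
rewrite -set_itvcy.
have -> : (\int[mu]_(x in `[0%R, +oo[) (h x)%:E)%E =
          (\int[mu]_(x in `[0%R, +oo[) (expR (- (c * x)))%:E)%E.
  apply: eq_integral => t; rewrite inE /= in_itv /= andbT => t0.
  by rewrite /h ger0_norm.
have dF (x : R) :
    is_derive x 1 (fun t => - c^-1 * expR (- c * t)) (expR (- c * x)).
  have d := is_deriveZ (- c^-1) (is_derive_expR_comp (is_derive_scale (- c) x)).
  apply: is_derive_eq d _; rewrite /GRing.scale /= mulrCA mulrNN mulVf ?mulr1//.
  by rewrite gt_eqF.
under eq_integral do rewrite -mulNr.
rewrite (@ge0_continuous_FTC2y _ _ (fun t => - c^-1 * expR (- c * t)) _ 0).
- by rewrite -EFinD -EFinM ltry.
- by move=> *; exact: expR_ge0.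
- apply: continuous_subspaceT => x; by apply: cvg_expR_comp; exact: cvgMr.
- rewrite -(mulr0 (- c^-1)); apply: cvgMr.
  under eq_fun do rewrite mulNr.
  apply: (cvg_comp (fun t => c * t) (fun t => expR (- t))); last exact: cvgr_expR.
  exact: gt0_cvgMry.
- by move=> x _; have [] := dF x.
- have cF : {for 0, continuous (fun t => - c^-1 * expR (- c * t))}.
    by apply/differentiable_continuous/derivable1_diffP; have [] := dF 0.
  exact: cvg_at_right_filter.
- by move=> x _; rewrite derive1E; have [] := dF x.
Qed.

(** The kernels below are continuous and decay exponentially at both ends of
    the line, which is how they are shown to be integrable. *)
Lemma exp_decay_integrable f (C c : R) :
  0 < c -> continuous f -> (forall t, `|f t| <= C * expR (- (c * `|t|))) ->
  mu.-integrable [set: R] (EFin \o f).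
Proof.
move=> c0 cf fC; apply: le_integrable (integrable_exp_decay C c0) => //.
  by apply/measurable_EFinP; exact: continuous_measurable_fun.
by move=> t _ /=; rewrite lee_fin (le_trans (fC t)) ?ler_norm.
Qed.

Lemma cvg_Rintegral_sym_itv f :
  mu.-integrable [set: R] (EFin \o f) ->
  (\int[mu]_(t in `[- n%:R, n%:R]) f t)%R @[n --> \oo] --> (\int[mu]_t f t)%R.
Proof.
move=> intf.
have mf : measurable_fun [set: R] f by apply/measurable_EFinP; case/integrableP : intf.
under eq_fun do rewrite Rintegral_mkcond.
apply: (@Rdominated_cvg _ _ R mu (fun n => f \_ `[- n%:R, n%:R]) f (fun t => `|f t|)) => //.
- by move=> n; apply/(measurable_restrictT _ _).1 => //; exact: measurable_funTS.
- apply: aeW => t; apply: cvg_near_cst.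
  near=> n; rewrite patchE mem_set//= in_itv /= -ler_norml.
  by near: n; exact: nbhs_infty_ger.
- exact: integrable_norm.
- by move=> n t; rewrite patchE; case: ifP => // _; rewrite normr0.
Unshelve. all: by end_near. Qed.

Lemma Rintegral_derivative_eq0 F f :
  (forall t : R, is_derive t 1 F (f t)) -> continuous f ->
  mu.-integrable [set: R] (EFin \o f) ->
  F t @[t --> +oo] --> 0 -> F t @[t --> -oo] --> 0 ->
  (\int[mu]_t f t)%R = 0.
Proof.
move=> dF cf intf Fy FNy.
rewrite -(cvg_lim (@Rhausdorff R) (cvg_Rintegral_sym_itv intf)); apply: cvg_lim => //.
have cF : continuous F.
  by move=> t; apply/differentiable_continuous/derivable1_diffP; have [] := dF t.
have E (n : nat) : (\int[mu]_(t in `[- n.+1%:R, n.+1%:R]) f t)%R = F n.+1%:R - F (- n.+1%:R).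
  rewrite /Rintegral (@continuous_FTC2 _ f F) //.
  - by rewrite gtrN ?ltr0n.
  - exact: continuous_subspaceT.
  - split.
    + by move=> t _; have [] := dF t.
    + by apply: cvg_at_right_filter; exact: cF.
    + by apply: cvg_at_left_filter; exact: cF.
  - by move=> t _; rewrite derive1E; have [] := dF t.
have ny : n.+1%:R @[n --> \oo] --> (+oo : set_system R).
  by rewrite (cvg_shiftS (fun n => n%:R : R)); exact: cvgr_idn.
have FF : F n.+1%:R - F (- n.+1%:R) @[n --> \oo] --> (0 - 0 : R).
  apply: cvgB; first exact: cvg_comp ny Fy.
  by apply: (cvg_comp _ (fun t => F (- t)) ny); exact/(cvgNy_compNP F).
rewrite subr0 in FF.
rewrite -(cvg_shiftS (fun n => (\int[mu]_(t in `[- n%:R, n%:R]) f t)%R)).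
by under eq_fun do rewrite E.
Qed.

End real_line_integrals.

(** * Changes of variables *)

Section substitutions.
Variable R : realType.
Local Notation mu := lebesgue_measure.
Implicit Types (f g F G : R -> R).

Lemma Rintegral_affine f (L c : R) : 0 < L -> continuous f ->
  (forall t, 0 <= f t) ->
  (\int[mu]_t (f (L * t + c) * L))%R = (\int[mu]_t f t)%R.
Proof.
move=> L0 cf f0; rewrite /Rintegral; congr fine.
pose F := fun t : R => L * t + c.
have dF (t : R) : is_derive t 1 F L.
  have d := is_deriveD (is_derive_scale L t) (is_derive_cst c t 1).
  by apply: is_derive_eq d _; rewrite addr0.
have F'E : (F^`())%classic = cst L.
  by apply/funext => t; rewrite derive1E; have [] := dF t.
rewrite (@increasing_ge0_integration_by_substitutionT _ F f) ?F'E //.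
- by move=> t u tu; rewrite /F ltrD2r ltr_pM2l.
- by move=> t; exact: cvg_cst.
- by apply/cvg_ex; exists L; exact: cvg_cst.
- by apply/cvg_ex; exists L; exact: cvg_cst.
- apply/(cvg_comp _ _ _ (@cvg_addrr_Ny R c)).
  exact: gt0_cvgMrNy.
- apply/(cvg_comp _ _ _ (@cvg_addrr R c)).
  exact: gt0_cvgMry.
Qed.

Lemma Rintegral_oppr f : continuous f ->
  mu.-integrable [set: R] (EFin \o f) ->
  mu.-integrable [set: R] (EFin \o (f \o -%R)) ->
  (\int[mu]_t f (- t))%R = (\int[mu]_t f t)%R.
Proof.
move=> cf intf intfN.
have c1 := cvg_Rintegral_sym_itv intf.
have c2 := cvg_Rintegral_sym_itv intfN.
have E (n : nat) : (\int[mu]_(t in `[- n%:R, n%:R]) (f \o -%R) t)%R =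
                   (\int[mu]_(t in `[- n%:R, n%:R]) f t)%R.
  rewrite /Rintegral; congr fine.
  have := @integration_by_substitution_oppr R f (- n%:R) n%:R.
  rewrite opprK => ->//.
  - by apply: (@le_trans _ _ 0) => //; rewrite oppr_le0.
  - exact: continuous_subspaceT.
have c2' : (\int[mu]_(t in `[- n%:R, n%:R]) f t)%R @[n --> \oo] -->
           (\int[mu]_t f (- t))%R.
  by apply: cvg_trans c2; apply: near_eq_cvg; apply: nearW => n; rewrite E.
exact: (cvg_unique (@Rhausdorff R) c2' c1).
Qed.

(** The substitution s = e^t, by exhausting the line with the intervals
    [-n, n], on which the substitution rule for segments applies. *)
Lemma ge0_integral_expR G :
  (forall s, 0 < s -> 0 <= G s) -> (forall s : R, 0 < s -> {for s, continuous G}) ->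
  (\int[mu]_(s in `]0%R, +oo[) (G s)%:E =
   \int[mu]_t (G (expR t) * expR t)%:E)%E.
Proof.
move=> G0 cG.
pose H t := G (expR t) * expR t.
have cH : continuous H.
  move=> t; apply: cvgM; last exact: continuous_expR.
  apply: (@continuous_comp _ _ _ expR G); first exact: continuous_expR.
  by apply: cG; exact: expR_gt0.
have U1 : `]0%R, +oo[%classic = \bigcup_n `[expR (- n%:R) : R, expR n%:R]%classic.
  apply/seteqP; split=> [s /=|s [n _] /=]; last first.
    by rewrite !in_itv /= andbT => /andP[+ _]; apply: lt_le_trans; exact: expR_gt0.
  rewrite in_itv /= andbT => s0.
  have [n sn] : exists n : nat, `|ln s| <= n%:R.
    by exists (Num.truncn `|ln s|).+1; rewrite ltW// truncnS_gt.
  exists n => //=; rewrite in_itv /= -{1 2}(@lnK _ s)// !ler_expR.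
  by move: sn; rewrite ler_norml.
have U2 : [set: R] = \bigcup_n `[(- n%:R) : R, n%:R]%classic.
  apply/seteqP; split=> // s _.
  exists (Num.truncn `|s|).+1 => //=; rewrite in_itv /= -ler_norml ltW//.
  exact: truncnS_gt.
have cvg1 : (\int[mu]_(s in `[expR (- n%:R) : R, expR n%:R]) (G s)%:E)%E
    @[n --> \oo] --> (\int[mu]_(s in `]0%R, +oo[) (G s)%:E)%E.
  rewrite U1; apply: ge0_nondecreasing_set_cvg_integral => //.
  - apply/nondecreasing_seqP => n; rewrite subsetEset => s /=.
    rewrite !in_itv /= => /andP[h1 h2].
    rewrite (le_trans _ h1) ?(le_trans h2)// ler_expR ?lerN2 ler_nat//.
  - move=> n; apply/measurable_EFinP.
    apply: subspace_continuous_measurable_fun => //.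
    apply: continuous_in_subspaceT => s; rewrite inE /= in_itv /= => /andP[h _].
    by apply: cG; apply: lt_le_trans h; exact: expR_gt0.
  - move=> n s /=; rewrite in_itv /= => /andP[h _]; rewrite lee_fin G0//.
    by apply: lt_le_trans h; exact: expR_gt0.
have cvg2 : (\int[mu]_(t in `[(- n%:R)%R, n%:R%R]) (H t)%:E)%E
    @[n --> \oo] --> (\int[mu]_t (H t)%:E)%E.
  rewrite [in X in _ --> X]U2; apply: ge0_nondecreasing_set_cvg_integral => //.
  - apply/nondecreasing_seqP => n; rewrite subsetEset => s /=.
    rewrite !in_itv /= => /andP[h1 h2].
    rewrite (le_trans _ h1) ?(le_trans h2)// ?lerN2 ler_nat//.
  - move=> n; apply/measurable_EFinP; apply: measurable_funTS.
    exact: continuous_measurable_fun.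
  - by move=> n s _; rewrite lee_fin mulr_ge0 ?expR_ge0// G0 ?expR_gt0.
have dE : ((@expR R)^`())%classic = expR.
  by apply/funext => t; rewrite derive1E; have [] := is_derive_expR t.
apply: (cvg_unique (@ereal_hausdorff R) cvg1); apply: cvg_trans cvg2.
apply: near_eq_cvg; near=> n.
rewrite (@integration_by_substitution_increasing _ expR G) ?dE //.
- by apply: (@le_trans _ _ 0) => //; rewrite oppr_le0.
- by move=> s t _ _; rewrite ltr_expR.
- by move=> t _; exact: continuous_expR.
- apply/cvg_ex; exists (expR (- n%:R)); apply: cvg_at_right_filter.
  exact: continuous_expR.
- apply/cvg_ex; exists (expR (n%:R)); apply: cvg_at_left_filter.
  exact: continuous_expR.
- split.
  + by move=> t _; exact: derivable_expR.
  + by apply: cvg_at_right_filter; exact: continuous_expR.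
  + by apply: cvg_at_left_filter; exact: continuous_expR.
- apply: continuous_in_subspaceT => s; rewrite inE /= in_itv /= => /andP[h _].
  by apply: cG; apply: lt_le_trans h; exact: expR_gt0.
Unshelve. all: by end_near. Qed.

Lemma euler_integralE (x : R) :
  euler_integral x = (\int[mu]_t expR (x * t - expR t))%R.
Proof.
rewrite /euler_integral /Rintegral ge0_integral_expR.
- congr fine; apply: eq_integral => t _; congr EFin.
  rewrite /powR gt_eqF ?expR_gt0// expRK -!expRD; congr expR; ring.
- by move=> s _; rewrite mulr_ge0 ?powR_ge0 ?expR_ge0.
- move=> s s0.
  have powc : {for s, continuous (fun u : R => u `^ (x - 1))}.
    apply/differentiable_continuous/derivable1_diffP; apply: derivable_powR.
    by rewrite in_itv /= andbT.
  have expc : {for s, continuous (fun u : R => expR (- u))}.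
    by apply: cvg_expR_comp; exact: cvgN.
  exact: (continuousM powc expc).
Qed.

End substitutions.

(** * Gamma integrals and the integral representation of powers *)

Section exponential_integrals.
Variable R : realType.
Local Notation mu := lebesgue_measure.
Implicit Types (f g F G : R -> R).

Lemma exp_decay_cvg0 F (C c : R) : 0 < c ->
  (forall t, `|F t| <= C * expR (- (c * `|t|))) -> F t @[t --> +oo] --> 0.
Proof.
move=> c0 FC.
have h : C * expR (- (c * t)) @[t --> +oo] --> 0.
  rewrite -[X in _ --> X](mulr0 C); apply: cvgMr.
  apply: (cvg_comp (fun t => c * t) (fun t => expR (- t))); last exact: cvgr_expR.
  exact: gt0_cvgMry.
apply/norm_cvg0P; apply: (squeeze_cvgr _ (cvg_cst 0) h).
near=> t; rewrite normr_ge0 /=.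
have t0 : 0 <= t by near: t; apply: nbhs_pinfty_ge; exact: num_real.
by have := FC t; rewrite (ger0_norm t0).
Unshelve. all: by end_near. Qed.

Lemma Rintegral_exp_decay_derivative_eq0 F f (C c : R) : 0 < c ->
  (forall t, `|F t| <= C * expR (- (c * `|t|))) ->
  (forall t : R, is_derive t 1 F (f t)) -> continuous f ->
  mu.-integrable [set: R] (EFin \o f) ->
  (\int[mu]_t f t)%R = 0.
Proof.
move=> c0 FC dF cf intf.
apply: (Rintegral_derivative_eq0 dF cf intf).
  exact: exp_decay_cvg0 c0 FC.
apply/(cvgNy_compNP F); apply: (exp_decay_cvg0 (C := C) c0) => t.
by rewrite (le_trans (FC _))// normrN.
Qed.

(** The integrand of int_0^oo s^(nu-1) e^(-b s - a/s) ds after s = e^t. *)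
Definition gamma_kernel (nu b a t : R) : R :=
  expR (nu * t - b * expR t - a * expR (- t)).

Lemma gamma_kernel_ge0 (nu b a t : R) : 0 <= gamma_kernel nu b a t.
Proof. exact: expR_ge0. Qed.

Lemma continuous_gamma_kernel (nu b a : R) : continuous (gamma_kernel nu b a).
Proof.
move=> t; apply: cvg_expR_comp; apply: cvgB; [apply: cvgB|]; apply: cvgMr => //.
  exact: continuous_expR.
by apply: cvg_expR_comp; exact: cvgN.
Qed.

(** For t >= 0 the term b e^t >= b t^2 / 2 outweighs the linear term; for
    t < 0 the factor e^(nu t) decays by itself. *)
Lemma gamma_kernel_decay (nu b a t : R) : 0 < nu -> 0 < b -> 0 <= a ->
  `|gamma_kernel nu b a t| <= expR (2 * nu ^+ 2 / b) * expR (- (nu * `|t|)).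
Proof.
move=> nu0 b0 a0; rewrite ger0_norm ?gamma_kernel_ge0// -expRD ler_expR.
have at0 : 0 <= a * expR (- t) by rewrite mulr_ge0 ?expR_ge0.
have nb0 : 0 <= 2 * nu ^+ 2 / b by rewrite divr_ge0 ?mulr_ge0 ?sqr_ge0 ?ltW.
have [t0|t0] := ger0P t.
  (* 2 nu t - b t^2 / 2 is at most 2 nu^2 / b: complete the square. *)
  have et : b * (t ^+ 2 / 2) <= b * expR t by rewrite ler_pM2l ?sqr_half_le_expR.
  have : 0 <= (b * t - 2 * nu) ^+ 2 / (2 * b).
    by rewrite divr_ge0 ?sqr_ge0// mulr_ge0// ltW.
  have -> : (b * t - 2 * nu) ^+ 2 / (2 * b) =
     b * (t ^+ 2 / 2) - 2 * (nu * t) + 2 * nu ^+ 2 / b.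
    by field; rewrite gt_eqF.
  lra.
have bt0 : 0 <= b * expR t by rewrite mulr_ge0 ?expR_ge0 ?ltW.
rewrite mulrN; lra.
Qed.

Lemma integrable_gamma_kernel (nu b a : R) : 0 < nu -> 0 < b -> 0 <= a ->
  mu.-integrable [set: R] (EFin \o gamma_kernel nu b a).
Proof.
move=> nu0 b0 a0; apply: (@exp_decay_integrable _ _ (expR (2 * nu ^+ 2 / b)) nu) => //.
  exact: continuous_gamma_kernel.
by move=> t; exact: gamma_kernel_decay.
Qed.

Definition gamma_integral (nu a : R) : R :=
  (\int[mu]_t gamma_kernel nu 1 a t)%R.

Lemma gamma_integral0 (nu : R) : gamma_integral nu 0 = euler_integral nu.
Proof.
rewrite euler_integralE; apply: eq_Rintegral => t _.
by rewrite /gamma_kernel mul0r subr0 mul1r.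
Qed.

Lemma Rintegral_gt0 f (m A : R) :
  mu.-integrable [set: R] (EFin \o f) -> (forall t, 0 <= f t) -> 0 < m ->
  (forall t, A <= t <= A + 1 -> m <= f t) ->
  0 < (\int[mu]_t f t)%R.
Proof.
move=> intf f0 m0 fm.
have sub : mu.-integrable `[A, A + 1] (EFin \o f).
  by apply: integrableS intf.
have intm : mu.-integrable `[A, A + 1] (EFin \o cst m).
  apply: continuous_compact_integrable; first exact: segment_compact.
  by apply: continuous_subspaceT => ?; exact: cvg_cst.
apply: (@lt_le_trans _ _ (\int[mu]_(t in `[A, A + 1]) cst m t)%R).
  rewrite Rintegral_cst//= lebesgue_measure_itv /= lte_fin ltrDl ltr01.
  by rewrite -EFinD /= addrAC subrr add0r mulr1.
apply: (@le_trans _ _ (\int[mu]_(t in `[A, A + 1]) f t)%R).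
  by apply: le_Rintegral => // t; rewrite /= in_itv; exact: fm.
rewrite fine_le//; [exact: integrable_fin_num|exact: integrable_fin_num|].
apply: ge0_subset_integral => //; first by case/integrableP : intf.
by move=> t _; rewrite lee_fin.
Qed.

Lemma euler_integral_gt0 (nu : R) : 0 < nu -> 0 < euler_integral nu.
Proof.
move=> nu0; rewrite -gamma_integral0.
apply: (@Rintegral_gt0 _ (expR (- expR 1)) 0).
- exact: integrable_gamma_kernel.
- by move=> t; exact: gamma_kernel_ge0.
- exact: expR_gt0.
- move=> t; rewrite add0r => /andP[t0 t1]; rewrite ler_expR mul0r subr0 mul1r.
  have : expR t <= expR 1 by rewrite ler_expR.
  have : 0 <= nu * t by rewrite mulr_ge0// ltW.
  lra.
Qed.

(** Integration by parts: x e^(x t - e^t) - e^((x+1) t - e^t) is the derivative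
    of e^(x t - e^t), which vanishes at both ends of the line. *)
Lemma euler_integralS (x : R) : 0 < x -> euler_integral (x + 1) = x * euler_integral x.
Proof.
move=> x0; rewrite -!gamma_integral0 /gamma_integral.
have x10 : 0 < x + 1 by rewrite addr_gt0.
have i1 := integrable_gamma_kernel x0 ltr01 (lexx 0).
have i2 := integrable_gamma_kernel x10 ltr01 (lexx 0).
have i1' : mu.-integrable [set: R] (EFin \o (fun t => x * gamma_kernel x 1 0 t)).
  exact: (integrableZl measurableT x i1).
rewrite -RintegralZl//; apply/eqP; rewrite eq_sym -subr_eq0 -RintegralB//; apply/eqP.
apply: (Rintegral_exp_decay_derivative_eq0 (F := gamma_kernel x 1 0) x0).
- by move=> t; exact: gamma_kernel_decay.
- move=> t.
  have d : is_derive t 1 (fun u : R => x * u - 1 * expR u - 0 * expR (- u)) (x - expR t).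
    have d := is_deriveB (is_deriveB (is_derive_scale x t)
      (is_deriveZ 1 (is_derive_expR t))) (is_derive_cst (0 : R) t 1).
    have -> : (fun u : R => x * u - 1 * expR u - 0 * expR (- u)) =
       ((fun u => x * u) \- (1 *: expR)) \- cst 0.
      by apply/funext => u /=; rewrite mul0r.
    by apply: is_derive_eq d _; rewrite subr0 scale1r.
  apply: is_derive_eq (is_derive_expR_comp d) _.
  rewrite mulrBr -expRD mulrC; congr (_ - expR _); rewrite /gamma_kernel; ring.
- move=> t; apply: cvgB; first by apply: cvgMr; exact: continuous_gamma_kernel.
  exact: continuous_gamma_kernel.
- exact: (integrableB measurableT i1' i2).
Qed.

(** The integrand of int_0^oo (1 - e^(-lam s)) s^(-q-1) ds after s = e^(-t). *)
Definition stable_kernel (lam q t : R) : R :=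
  (1 - expR (- (lam * expR (- t)))) * expR (q * t).

Lemma onem_expRN_ge0 (x : R) : 0 <= x -> 0 <= 1 - expR (- x).
Proof. by move=> x0; rewrite subr_ge0 expR_le1 oppr_le0. Qed.

Lemma onem_expRN_le (x : R) : 1 - expR (- x) <= x.
Proof. by have := expR_ge1Dx (- x); lra. Qed.

Lemma onem_expRN_ge (x : R) : x * expR (- x) <= 1 - expR (- x).
Proof.
have h := expR_ge1Dx x.
rewrite -(ler_pM2r (expR_gt0 x)) -mulrA mulrBl mul1r -expRD addNr expR0 mulr1; lra.
Qed.

Lemma stable_kernel_ge0 (lam q t : R) : 0 <= lam -> 0 <= stable_kernel lam q t.
Proof.
move=> lam0; rewrite mulr_ge0 ?expR_ge0// onem_expRN_ge0//.
by rewrite mulr_ge0 ?expR_ge0.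
Qed.

Lemma continuous_stable_kernel (lam q : R) : continuous (stable_kernel lam q).
Proof.
move=> t; apply: cvgM.
  apply: cvgB; first exact: cvg_cst.
  by apply: cvg_expR_comp; apply: cvgN; apply: cvgMr; apply: cvg_expR_comp; exact: cvgN.
by apply: cvg_expR_comp; exact: cvgMr.
Qed.

Lemma stable_kernel_decay (lam q t : R) : 0 <= lam -> 0 < q < 1 ->
  `|stable_kernel lam q t| <=
    (1 + lam) * expR (- (Num.min q (1 - q) * `|t|)).
Proof.
move=> lam0 /andP[q0 q1]; rewrite ger0_norm ?stable_kernel_ge0//.
have [t0|t0] := ger0P t.
  apply: (@le_trans _ _ (lam * expR (- t) * expR (q * t))).
    by rewrite ler_pM2r ?expR_gt0// onem_expRN_le.
  rewrite -mulrA -expRD; apply: ler_pM; rewrite ?expR_ge0//; first by rewrite lerDr.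
  rewrite ler_expR; have : Num.min q (1 - q) * t <= (1 - q) * t.
    by rewrite ler_wpM2r// ge_min lexx orbT.
  lra.
apply: ler_pM; rewrite ?expR_ge0//.
- by rewrite onem_expRN_ge0// mulr_ge0 ?expR_ge0.
- by have := expR_ge0 (- (lam * expR (- t))); lra.
have h : Num.min q (1 - q) <= q by rewrite ge_min lexx.
by rewrite ler_expR mulrN opprK ler_wnM2r// ltW.
Qed.

Lemma integrable_stable_kernel (lam q : R) : 0 <= lam -> 0 < q < 1 ->
  mu.-integrable [set: R] (EFin \o stable_kernel lam q).
Proof.
move=> lam0 /andP[q0 q1]; apply: (@exp_decay_integrable _ _ (1 + lam) (Num.min q (1 - q))).
- by rewrite lt_min q0 subr_gt0.
- exact: continuous_stable_kernel.
- by move=> t; apply: stable_kernel_decay; rewrite ?q0.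
Qed.

Definition stable_const (q : R) : R := (\int[mu]_t stable_kernel 1 q t)%R.

(** Homogeneity in lam, by the translation t = u + ln lam. *)
Lemma Rintegral_stable_kernel (lam q : R) : 0 <= lam -> 0 < q < 1 ->
  (\int[mu]_t stable_kernel lam q t)%R = lam `^ q * stable_const q.
Proof.
move=> lam0 q01; have [q0 q1] := andP q01.
have [->|lam_neq0] := eqVneq lam 0.
  transitivity (\int[mu]_(t in [set: R]) cst 0 t)%R; last first.
    by rewrite Rintegral_cst// mul0r powR0 ?gt_eqF// mul0r.
  by apply: eq_Rintegral => t _; rewrite /stable_kernel mul0r oppr0 expR0 subrr mul0r.
have lam_gt0 : 0 < lam by rewrite lt_neqAle eq_sym lam_neq0.
rewrite /stable_const -RintegralZl//; last exact: integrable_stable_kernel.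
rewrite -(@Rintegral_affine _ (stable_kernel lam q) 1 (ln lam))//; last 2 first.
  exact: continuous_stable_kernel.
  by move=> t; exact: stable_kernel_ge0.
apply: eq_Rintegral => t _; rewrite mulr1 mul1r /stable_kernel mul1r opprD expRD.
rewrite (expRN (ln lam)) lnK ?posrE// mulrCA mulfV// mulr1 mulrDr expRD [RHS]mulrCA.
by congr (_ * _); rewrite mulrC /powR (negbTE lam_neq0).
Qed.

(** Integration by parts. It identifies the constant with - Gamma(-q), which is
    the coefficient of the Matern expansion for nu < 1. *)
Lemma stable_const_gamma (q : R) :
  0 < q < 1 -> q * stable_const q = euler_integral (1 - q).
Proof.
move=> /andP[q0 q1]; have q01 : 0 < q < 1 by rewrite q0.
have q10 : 0 < 1 - q by rewrite subr_gt0.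
have i1 := integrable_stable_kernel ler01 q01.
have i1' : mu.-integrable [set: R] (EFin \o (fun t => q * stable_kernel 1 q t)).
  exact: (integrableZl measurableT q i1).
have i2 := integrable_gamma_kernel q10 ltr01 (lexx 0).
have i2N : mu.-integrable [set: R] (EFin \o (gamma_kernel (1 - q) 1 0 \o -%R)).
  apply: (@exp_decay_integrable _ _ (expR (2 * (1 - q) ^+ 2 / 1)) (1 - q)) => //.
    by move=> t; apply: continuous_comp; [exact: oppr_continuous|exact: continuous_gamma_kernel].
  by move=> t; rewrite -(normrN t) /=; exact: gamma_kernel_decay.
rewrite -gamma_integral0 /gamma_integral -(Rintegral_oppr _ i2)//; last first.
  exact: continuous_gamma_kernel.
rewrite -RintegralZl//; apply/eqP; rewrite -subr_eq0 -RintegralB//; apply/eqP.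
have c0 : 0 < Num.min q (1 - q) by rewrite lt_min q0.
apply: (Rintegral_exp_decay_derivative_eq0 (F := stable_kernel 1 q) c0).
- by move=> t; exact: stable_kernel_decay.
- move=> t.
  have dN : is_derive t 1 (fun u : R => 1 * expR (-1 * u)) (1 * (expR (-1 * t) * -1)).
    exact: (is_deriveZ 1 (is_derive_expR_comp (is_derive_scale (-1) t))).
  have dE := is_derive_expR_comp (is_deriveN dN).
  have dq := is_derive_expR_comp (is_derive_scale q t).
  have d := is_deriveM (is_deriveB (is_derive_cst (1 : R) t 1) dE) dq.
  have -> : stable_kernel 1 q =
      (cst 1 \- (fun u => expR (- (1 * expR (-1 * u))))) \* (fun u => expR (q * u)).
    by apply/funext => u /=; rewrite mulN1r.
  apply: is_derive_eq d _; rewrite /GRing.scale /= /stable_kernel /gamma_kernel.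
  rewrite !mulN1r mul0r subr0 !mul1r sub0r.
  have -> : (1 - q) * - t - expR (- t) = q * t + (- t) + (- expR (- t)) by ring.
  rewrite !fctE /= mulN1r !mul1r !expRD; ring.
- move=> t; apply: cvgB; first by apply: cvgMr; exact: continuous_stable_kernel.
  by apply: continuous_comp; [exact: oppr_continuous|exact: continuous_gamma_kernel].
- exact: (integrableB measurableT i1' i2N).
Qed.

End exponential_integrals.

(** * Powers of distances are conditionally negative definite *)

Section real_integral_sum.
Context d (T : measurableType d) (R : realType) (mu : {measure set T -> \bar R}).

Lemma Rintegral_sum (I : Type) (s : seq I) (f : I -> T -> R) :
  (forall i, mu.-integrable setT (EFin \o f i)) ->
  mu.-integrable setT (EFin \o (fun t => \sum_(i <- s) f i t)) /\
  (\int[mu]_t \sum_(i <- s) f i t)%R = \sum_(i <- s) (\int[mu]_t f i t)%R.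
Proof.
move=> intf; elim: s => [|i s [ints IHs]].
  rewrite big_nil; under [X in EFin \o X]eq_fun do rewrite big_nil.
  split; first exact: integrable0.
  by under eq_Rintegral do rewrite big_nil; rewrite Rintegral_cst// mul0r.
rewrite big_cons -IHs -RintegralD//; split; last first.
  by apply: eq_Rintegral => t _; rewrite big_cons.
under [X in EFin \o X]eq_fun do rewrite big_cons.
exact: (integrableD measurableT (intf i) ints).
Qed.

End real_integral_sum.

Section power_distance.
Variable R : realType.
Local Notation mu := lebesgue_measure.

Lemma cvgr_expRy : expR t @[t --> +oo] --> (+oo : set_system R).
Proof.
apply/cvgryPge => A; near=> t.
apply: (@le_trans _ _ (1 + t)); last exact: expR_ge1Dx.
rewrite -lerBlDl; near: t; apply: nbhs_pinfty_ge; exact: num_real.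
Unshelve. all: by end_near. Qed.

Lemma gaussian_cvgNy (lam : R) : 0 < lam ->
  expR (- (expR (- t) * lam)) @[t --> -oo] --> 0.
Proof.
move=> lam0; apply/(cvgNy_compNP (fun t => expR (- (expR (- t) * lam)))).
apply: (cvg_comp (fun t => expR (- - t) * lam) (fun t => expR (- t))); last exact: cvgr_expR.
apply: gt0_cvgMly => //; under eq_fun do rewrite opprK; exact: cvgr_expRy.
Qed.

(** Writing each power as an integral and using that the c i sum to 0, the
    quadratic form times the constant is minus the integral of
    G(t) e^(q t), where G is the Gaussian quadratic form at scale e^(-t). G is
    nonnegative everywhere, and as t --> -oo it tends to the sum of the
    c i ^+ 2, since the points are distinct; so the integral is positive. *)
Lemma sqdist_power_cond_neg (n r : nat) (x : 'I_n -> 'rV[R]_r) (q : R)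
    (c : 'I_n -> R) :
  injective x -> 0 < q < 1 -> \sum_i c i = 0 -> (exists i, c i != 0) ->
  \sum_i \sum_j c i * c j * sqdist (x i) (x j) `^ q < 0.
Proof.
move=> x_inj q01 sum_c [i0 ci0].
pose G t := \sum_i \sum_j c i * c j * expR (- (expR (- t) * sqdist (x i) (x j))).
have G_ge0 t : 0 <= G t by apply: gaussian_psd; exact: expR_ge0.
pose k i j t := c i * c j * stable_kernel (sqdist (x i) (x j)) q t.
have intk i j : mu.-integrable [set: R] (EFin \o k i j).
  exact: (integrableZl measurableT (c i * c j)
           (integrable_stable_kernel (sqdist_ge0 _ _) q01)).
have sum_k t : \sum_i \sum_j k i j t = - (G t * expR (q * t)).
  rewrite /k /G /stable_kernel.
  under eq_bigr do under eq_bigr do rewrite mulrA mulrBr mulr1 mulrBl.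
  under eq_bigr do rewrite sumrB -!mulr_suml -mulr_sumr sum_c mulr0 mul0r sub0r.
  rewrite sumrN mulr_suml; congr (- _); apply: eq_bigr => i _; congr (_ * _).
  by apply: eq_bigr => j _; congr (_ * expR (- _)); rewrite mulrC.
have [int1 E1] : mu.-integrable [set: R] (EFin \o (fun t => \sum_i \sum_j k i j t)) /\
   (\int[mu]_t \sum_i \sum_j k i j t)%R = \sum_i \sum_j (\int[mu]_t k i j t)%R.
  have inti i := @Rintegral_sum _ _ R mu _ (index_enum _) (k i) (intk i).
  have [h1 h2] := @Rintegral_sum _ _ R mu _ (index_enum _)
    (fun i t => \sum_j k i j t) (fun i => (inti i).1).
  by split=> //; rewrite h2; apply: eq_bigr => i _; exact: (inti i).2.
have E2 : \sum_i \sum_j (\int[mu]_t k i j t)%R =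
    (\sum_i \sum_j c i * c j * sqdist (x i) (x j) `^ q) * stable_const q.
  rewrite mulr_suml; apply: eq_bigr => i _; rewrite mulr_suml; apply: eq_bigr => j _.
  rewrite (RintegralZl _ measurableT (integrable_stable_kernel (sqdist_ge0 _ _) q01)).
  by rewrite Rintegral_stable_kernel ?sqdist_ge0// mulrA.
have intG : mu.-integrable [set: R] (EFin \o (fun t => G t * expR (q * t))).
  have := integrableZl measurableT (-1) int1.
  by apply: eq_integrable => // t _ /=; rewrite sum_k -EFinM mulN1r opprK.
have E3 : (\int[mu]_t \sum_i \sum_j k i j t)%R = - (\int[mu]_t (G t * expR (q * t)))%R.
  rewrite -mulN1r -RintegralZl//.
  by apply: eq_Rintegral => t _; rewrite sum_k mulN1r.
have K_gt0 : 0 < \sum_i c i ^+ 2.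
  rewrite (bigD1 i0)//= ltr_pwDl ?exprn_even_gt0//.
  by apply: sumr_ge0 => i _; exact: sqr_ge0.
have cvgG : G t @[t --> -oo] --> \sum_i c i ^+ 2.
  rewrite (_ : \sum_i c i ^+ 2 = \sum_i \sum_j c i * c j * (i == j)%:R); last first.
    apply: eq_bigr => i _; rewrite (bigD1 i)//= eqxx mulr1 big1 ?addr0//.
    by move=> j /negbTE; rewrite eq_sym => ->; rewrite mulr0.
  apply: cvg_sum_fin => i; apply: cvg_sum_fin => j; apply: cvgMr.
  have [->|ij] := eqVneq i j.
    rewrite sqdistxx; under eq_fun do rewrite mulr0 oppr0 expR0; exact: cvg_cst.
  apply: gaussian_cvgNy; apply: sqdist_gt0; apply: contra_neq ij; exact: x_inj.
have [A [_ GA]] : \forall t \near -oo, (\sum_i c i ^+ 2) / 2 < G t.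
  by apply: (cvgr_gt _ cvgG); rewrite ltr_pdivrMr// ltr_pMr// ltr1n.
have Gint_gt0 : 0 < (\int[mu]_t (G t * expR (q * t)))%R.
  (* [A - 2, A - 1] lies in the half-line t < A where G is bounded below. *)
  apply: (@Rintegral_gt0 _ _ ((\sum_i c i ^+ 2) / 2 * expR (q * (A - 2))) (A - 2) intG).
  - by move=> t; rewrite mulr_ge0 ?expR_ge0.
  - by rewrite mulr_gt0 ?expR_gt0// divr_gt0.
  - move=> t /andP[t1 t2]; apply: ler_pM; rewrite ?expR_ge0//.
    + by rewrite divr_ge0// ltW.
    + by apply/ltW/GA; clear -t2; lra.
    + by rewrite ler_expR ler_pM2l//; case/andP: q01.
have C_ge0 : 0 <= stable_const q.
  by apply: Rintegral_ge0 => t _; exact: stable_kernel_ge0.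
have SC : (\sum_i \sum_j c i * c j * sqdist (x i) (x j) `^ q) * stable_const q < 0.
  by rewrite -E2 -E1 E3 oppr_lt0.
have C_gt0 : 0 < stable_const q.
  rewrite lt_neqAle C_ge0 andbT; apply: contraTneq SC => <-.
  by rewrite mulr0 ltxx.
by rewrite pmulr_llt0 in SC.
Qed.

End power_distance.

(** * Behaviour of the gamma integral near a = 0 *)

Section matern.
Variable R : realType.
Local Notation mu := lebesgue_measure.

(** The integrand of M(nu, 0) - M(nu, a), with s = e^t. *)
Definition gamma_defect (nu a t : R) : R :=
  gamma_kernel nu 1 0 t * (1 - expR (- (a * expR (- t)))).

Lemma gamma_defect_ge0 (nu a t : R) : 0 <= a -> 0 <= gamma_defect nu a t.
Proof.
by move=> a0; rewrite mulr_ge0 ?gamma_kernel_ge0// onem_expRN_ge0// mulr_ge0 ?expR_ge0.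
Qed.

Lemma continuous_gamma_defect (nu a : R) : continuous (gamma_defect nu a).
Proof.
move=> t; apply: cvgM; first exact: continuous_gamma_kernel.
apply: cvgB; first exact: cvg_cst.
by apply: cvg_expR_comp; apply: cvgN; apply: cvgMr; apply: cvg_expR_comp; exact: cvgN.
Qed.

Lemma gamma_integral_defect (nu a : R) : 0 < nu -> 0 <= a ->
  euler_integral nu - gamma_integral nu a = (\int[mu]_t gamma_defect nu a t)%R.
Proof.
move=> nu0 a0; rewrite -gamma_integral0 -RintegralB//.
- apply: eq_Rintegral => t _; rewrite /gamma_defect /gamma_kernel mulrBr mulr1.
  by rewrite -expRD mul0r subr0.
- exact: integrable_gamma_kernel.
- exact: integrable_gamma_kernel.
Qed.

Lemma cvg_expRN_scale (y : R) : expR (- (a * y)) @[a --> 0^'+] --> (1 : R).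
Proof.
rewrite (_ : 1 = expR (- (0 * y))); last by rewrite mul0r oppr0 expR0.
apply: (@cvg_at_right_filter _ _ (fun a => expR (- (a * y)))).
by apply: cvg_expR_comp; apply: cvgN; apply: cvgMl; exact: cvg_id.
Qed.

(** The translation t = u + ln a turns the defect into a^nu times an integrand
    that increases to [stable_kernel 1 nu u] as a decreases to 0. *)
Lemma gamma_integral_rough (nu : R) : 0 < nu < 1 ->
  (gamma_integral nu a - euler_integral nu) / a `^ nu @[a --> 0^'+]
    --> - stable_const nu.
Proof.
move=> nu01; have [nu0 nu1] := andP nu01.
pose f (a u : R) := expR (- (a * expR u)) * stable_kernel 1 nu u.
have f_le a u : 0 <= a -> `|f a u| <= stable_kernel 1 nu u.
  move=> a0; rewrite /f normrM ger0_norm ?expR_ge0// ger0_norm ?stable_kernel_ge0//.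
  by rewrite ler_piMl ?stable_kernel_ge0// expR_le1 oppr_le0 mulr_ge0 ?expR_ge0.
have cf a : continuous (f a).
  move=> u; apply: cvgM; last exact: continuous_stable_kernel.
  by apply: cvg_expR_comp; apply: cvgN; apply: cvgMr; exact: continuous_expR.
have intf a : 0 <= a -> mu.-integrable [set: R] (EFin \o f a).
  move=> a0; apply: le_integrable (integrable_stable_kernel ler01 nu01) => //.
    by apply/measurable_EFinP; exact: continuous_measurable_fun.
  by move=> u _ /=; rewrite lee_fin (le_trans (f_le _ _ a0))// ler_norm.
have E a : 0 < a -> (gamma_integral nu a - euler_integral nu) / a `^ nu =
    - (\int[mu]_u f a u)%R.
  move=> a0; have a_ge0 := ltW a0.
  rewrite -opprB gamma_integral_defect// mulNr; congr (- _).
  apply: (@mulIf _ (a `^ nu)); first by rewrite gt_eqF ?powR_gt0.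
  rewrite mulfVK ?gt_eqF ?powR_gt0// mulrC -RintegralZl//; last exact: intf.
  rewrite -(@Rintegral_affine _ (gamma_defect nu a) 1 (ln a))//; last 2 first.
    exact: continuous_gamma_defect.
    by move=> t; exact: gamma_defect_ge0.
  apply: eq_Rintegral => t _; rewrite mulr1 mul1r /gamma_defect /gamma_kernel /f.
  rewrite /stable_kernel /powR gt_eqF// !mul1r mul0r subr0 opprD !expRD.
  have -> : a * (expR (- t) * expR (- ln a)) = expR (- t).
    by rewrite (expRN (ln a)) lnK ?posrE// mulrCA mulfV ?gt_eqF// mulr1.
  by rewrite (mulrDr nu) expRD lnK ?posrE// (mulrC a); ring.
have cvgf : (\int[mu]_u f a u)%R @[a --> 0^'+] --> stable_const nu.
  apply: (@Rdominated_cvg_at_right _ _ R mu f _ (stable_kernel 1 nu)).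
  - by move=> a; exact: continuous_measurable_fun.
  - by apply: continuous_measurable_fun; exact: continuous_stable_kernel.
  - apply: aeW => u; rewrite -[X in _ --> X]mul1r; apply: cvgMl.
    exact: cvg_expRN_scale.
  - exact: integrable_stable_kernel.
  - by near=> a => t; apply: f_le; rewrite ltW.
apply: cvg_trans (cvgN cvgf); apply: near_eq_cvg; near=> a.
by rewrite E.
Unshelve. all: by end_near. Qed.

(** (1 - e^(-a y)) / a increases to y = e^(-t) as a decreases to 0, and
    multiplying by e^(-t) lowers the exponent nu by one; the bound is integrable
    exactly because nu > 1. *)
Lemma gamma_integral_smooth (nu : R) : 1 < nu ->
  (gamma_integral nu a - euler_integral nu) / a @[a --> 0^'+]
    --> - euler_integral (nu - 1).
Proof.
move=> nu1; have nu0 : 0 < nu by rewrite (lt_trans ltr01).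
have nu10 : 0 < nu - 1 by rewrite subr_gt0.
pose f (a u : R) := a^-1 * gamma_defect nu a u.
have cf a : continuous (f a).
  by move=> u; apply: cvgMr; exact: continuous_gamma_defect.
have gkE u : gamma_kernel (nu - 1) 1 0 u = gamma_kernel nu 1 0 u * expR (- u).
  by rewrite /gamma_kernel -expRD; congr expR; ring.
have f_le a u : 0 < a -> f a u <= gamma_kernel (nu - 1) 1 0 u.
  move=> a0; rewrite /f mulrC ler_pdivrMr// gkE -mulrA ler_pM2l ?expR_gt0//.
  by rewrite [leRHS]mulrC onem_expRN_le.
have f_ge a u : 0 < a ->
    gamma_kernel (nu - 1) 1 0 u * expR (- (a * expR (- u))) <= f a u.
  move=> a0; rewrite /f [leRHS]mulrC ler_pdivlMr// gkE -!mulrA ler_pM2l ?expR_gt0//.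
  by rewrite mulrC -mulrA mulrC onem_expRN_ge.
have f_ge0 a u : 0 < a -> 0 <= f a u.
  by move=> a0; rewrite mulr_ge0 ?invr_ge0 ?gamma_defect_ge0// ltW.
have intg := integrable_gamma_kernel nu10 ltr01 (lexx 0).
have intf a : 0 < a -> mu.-integrable [set: R] (EFin \o gamma_defect nu a).
  move=> a0; apply: le_integrable (integrable_gamma_kernel nu0 ltr01 (lexx 0)) => //.
    apply/measurable_EFinP; apply: continuous_measurable_fun.
    exact: continuous_gamma_defect.
  move=> u _ /=; rewrite lee_fin !ger0_norm ?gamma_kernel_ge0 ?(gamma_defect_ge0 _ _ (ltW a0))//.
  by rewrite /gamma_defect ler_piMr ?gamma_kernel_ge0// gerBl expR_ge0.
have E a : 0 < a -> (gamma_integral nu a - euler_integral nu) / a =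
    - (\int[mu]_u f a u)%R.
  move=> a0; rewrite -opprB gamma_integral_defect ?ltW// mulNr; congr (- _).
  by rewrite mulrC -RintegralZl//; exact: intf.
have cvgf : (\int[mu]_u f a u)%R @[a --> 0^'+] --> euler_integral (nu - 1).
  rewrite -gamma_integral0.
  apply: (@Rdominated_cvg_at_right _ _ R mu f _ (gamma_kernel (nu - 1) 1 0)).
  - by move=> a; exact: continuous_measurable_fun.
  - by apply: continuous_measurable_fun; exact: continuous_gamma_kernel.
  - apply: aeW => u.
    apply: (squeeze_cvgr (f := fun a => gamma_kernel (nu - 1) 1 0 u * expR (- (a * expR (- u))))
      _ _ (cvg_cst _)).
      by near=> a; rewrite f_ge ?f_le.
    rewrite -[X in _ --> X]mulr1; apply: cvgMr.
    exact: cvg_expRN_scale.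
  - exact: intg.
  - by near=> a => t; rewrite ger0_norm ?f_ge0 ?f_le.
apply: cvg_trans (cvgN cvgf); apply: near_eq_cvg; near=> a.
by rewrite E.
Unshelve. all: by end_near. Qed.

End matern.

(** * The logarithmic case nu = 1 *)

Section matern_critical.
Variable R : realType.
Local Notation mu := lebesgue_measure.

(** With L = - ln a, the defect at t = L (w - 1), multiplied by the Jacobian L
    and divided by a L. The logarithm arises because, before the stretching,
    the defect divided by a is close to 1 on an interval of length L and small outside
    it: after the stretching it tends to the indicator of ]0, 1[. *)
Definition critical_kernel (a w : R) : R :=
  expR (- expR (- ln a * (w - 1))) * stable_kernel 1 1 (- ln a * w).

Lemma continuous_critical_kernel (a : R) : continuous (critical_kernel a).
Proof.
move=> w; apply: cvgM.
  apply: cvg_expR_comp; apply: cvgN; apply: cvg_expR_comp; apply: cvgMr.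
  by apply: cvgB => //; exact: cvg_cst.
apply: (@continuous_comp _ _ _ (fun w => - ln a * w) (stable_kernel 1 1)).
  by apply: cvgMr.
exact: continuous_stable_kernel.
Qed.

Lemma stable_kernel11_le1 (v : R) : stable_kernel 1 1 v <= 1.
Proof.
rewrite /stable_kernel !mul1r.
apply: (@le_trans _ _ (expR (- v) * expR v)).
  by rewrite ler_pM2r ?expR_gt0// onem_expRN_le.
by rewrite -expRD addNr expR0.
Qed.

Lemma stable_kernel11_le_expR (v : R) : stable_kernel 1 1 v <= expR v.
Proof.
by rewrite /stable_kernel !mul1r ler_piMl ?expR_ge0// gerBl expR_ge0.
Qed.

Lemma stable_kernel11_ge (v : R) : expR (- expR (- v)) <= stable_kernel 1 1 v.
Proof.
rewrite /stable_kernel !mul1r; have := onem_expRN_ge (expR (- v)).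
by rewrite -(ler_pM2r (expR_gt0 v)) mulrAC -expRD addNr expR0 mul1r.
Qed.

Lemma critical_kernel_ge0 (a w : R) : 0 <= critical_kernel a w.
Proof. by rewrite mulr_ge0 ?expR_ge0 ?stable_kernel_ge0. Qed.

(** For w >= 0 the double exponential satisfies e^(L (w - 1)) >= w - 1, and for
    w < 0 the second factor is at most e^(L w); L >= 1 makes both bounds
    uniform in a. *)
Lemma critical_kernel_decay (a w : R) : 1 <= - ln a ->
  `|critical_kernel a w| <= expR 1 * expR (- (1 * `|w|)).
Proof.
move=> L1; rewrite ger0_norm ?critical_kernel_ge0// mul1r /critical_kernel.
set L := - ln a in L1 *; have L0 : 0 <= L by rewrite (le_trans ler01).
have [w0|w0] := ger0P w.
  rewrite -[leRHS]mulr1; apply: ler_pM; rewrite ?expR_ge0 ?stable_kernel_ge0//.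
    rewrite -expRD ler_expR.
    have [w1|w1] := leP w 1; first by have := expR_ge0 (L * (w - 1)); lra.
    have := expR_ge1Dx (L * (w - 1)).
    have : w - 1 <= L * (w - 1) by rewrite ler_peMl// subr_ge0 ltW.
    lra.
  exact: stable_kernel11_le1.
apply: ler_pM; rewrite ?expR_ge0 ?stable_kernel_ge0//.
  by rewrite (@le_trans _ _ 1)// ?expR_le1 ?oppr_le0 ?expR_ge0// -expR0 ler_expR.
apply: (le_trans (stable_kernel11_le_expR _)).
by rewrite ler_expR opprK ler_neMl// ltW.
Qed.

Lemma cvg_opp_ln : - ln a @[a --> (0 : R)^'+] --> (+oo : set_system R).
Proof. by apply/cvgNrNy; under eq_cvg do rewrite opprK; exact: lnNy. Qed.

Lemma cvg_expRN_0 (T : Type) (F : set_system T) (FF : Filter F) (f : T -> R) :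
  f t @[t --> F] --> 0 -> expR (- f t) @[t --> F] --> (1 : R).
Proof. by move=> f0; rewrite -expR0 -oppr0; apply: cvg_expR_comp; exact: cvgN. Qed.

Lemma cvg_expR_scale_lt0 (c : R) : c < 0 ->
  expR (- ln a * c) @[a --> 0^'+] --> 0.
Proof.
move=> c0.
rewrite (_ : (fun a => _) = (fun a => expR (- (- ln a * - c)))); last first.
  by apply/funext => a; rewrite mulrN opprK.
apply: (cvg_comp (fun a => - ln a * - c) (fun t => expR (- t))); last exact: cvgr_expR.
by apply: gt0_cvgMly; [rewrite oppr_gt0|exact: cvg_opp_ln].
Qed.

Lemma cvg_expR_scale_gt0 (c : R) : 0 < c ->
  expR (- expR (- ln a * c)) @[a --> 0^'+] --> 0.
Proof.
move=> c0.
apply: (cvg_comp (fun a => expR (- ln a * c)) (fun t => expR (- t))); last exact: cvgr_expR.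
apply: (cvg_comp (fun a => - ln a * c) expR); last exact: cvgr_expRy.
by apply: gt0_cvgMly => //; exact: cvg_opp_ln.
Qed.

(** At w = 0 and w = 1 the limit is different, hence the two exclusions. *)
Lemma critical_kernel_cvg (w : R) : w != 0 -> w != 1 ->
  critical_kernel a w @[a --> 0^'+] --> (\1_(`]0, 1[%classic) w : R).
Proof.
move=> w0 w1; rewrite indicE; have [wlt0|w_ge0] := ltP w 0.
  rewrite memNset/=; last by rewrite in_itv /= ltNge ltW.
  apply: (squeeze_cvgr _ (cvg_cst 0) (cvg_expR_scale_lt0 wlt0)).
  near=> a; rewrite critical_kernel_ge0 /=.
  rewrite (le_trans _ (stable_kernel11_le_expR _))//.
  by rewrite ler_piMl ?stable_kernel_ge0// expR_le1 oppr_le0 expR_ge0.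
have w_gt0 : 0 < w by rewrite lt_neqAle eq_sym w0.
have [w_lt1|w_ge1] := ltP w 1; last first.
  have w_gt1 : 0 < w - 1 by rewrite subr_gt0 lt_neqAle eq_sym w1.
  rewrite memNset/=; last by rewrite in_itv /= (ltNge w 1) w_ge1 andbF.
  apply: (squeeze_cvgr _ (cvg_cst 0) (cvg_expR_scale_gt0 w_gt1)).
  near=> a; rewrite critical_kernel_ge0 /=.
  by rewrite ler_piMr ?expR_ge0// stable_kernel11_le1.
rewrite mem_set /=; last by rewrite in_itv /= w_gt0.
rewrite -[X in _ --> X]mulr1; apply: cvgM.
  have wm1 : w - 1 < 0 by rewrite subr_lt0.
  exact: cvg_expRN_0 (cvg_expR_scale_lt0 wm1).
apply: (squeeze_cvgr (f := fun a => expR (- expR (- ln a * - w))) _ _ (cvg_cst _)).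
  near=> a; rewrite stable_kernel11_le1 andbT.
  by rewrite mulrN stable_kernel11_ge.
have Nw : - w < 0 by rewrite oppr_lt0.
exact: cvg_expRN_0 (cvg_expR_scale_lt0 Nw).
Unshelve. all: by end_near. Qed.

Lemma gamma_integral_critical :
  (gamma_integral 1 a - euler_integral 1) / (a * ln a) @[a --> 0^'+] --> (1 : R).
Proof.
have E (a : R) : 0 < a -> 1 <= - ln a ->
    (gamma_integral 1 a - euler_integral 1) / (a * ln a) =
    (\int[mu]_w critical_kernel a w)%R.
  move=> a0 L1; have L0 : 0 < - ln a by rewrite (lt_le_trans ltr01).
  have lna0 : ln a != 0 by rewrite -oppr_eq0 gt_eqF.
  have aneq0 : a != 0 by rewrite gt_eqF.
  have intc : mu.-integrable [set: R] (EFin \o critical_kernel a).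
    apply: (@exp_decay_integrable _ _ (expR 1) 1) => //.
      exact: continuous_critical_kernel.
    by move=> w; exact: critical_kernel_decay.
  rewrite -opprB gamma_integral_defect ?ltW// mulNr -mulrN -invrN -mulrN.
  apply: (@mulIf _ (a * - ln a)); first by rewrite mulf_neq0 ?oppr_eq0.
  rewrite mulfVK; last by rewrite mulf_neq0 ?oppr_eq0.
  rewrite mulrC -(RintegralZl _ measurableT intc).
  rewrite -(@Rintegral_affine _ (gamma_defect 1 a) (- ln a) (ln a))//; last 2 first.
    exact: continuous_gamma_defect.
    by move=> t; rewrite gamma_defect_ge0// ltW.
  apply: eq_Rintegral => w _; rewrite [RHS]mulrAC; congr (_ * _).
  have e1 : - ln a * w + ln a = - ln a * (w - 1) by ring.
  have e2 : expR (ln a) = a by rewrite lnK ?posrE.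
  rewrite /gamma_defect /gamma_kernel /critical_kernel /stable_kernel !mul1r mul0r subr0.
  have -> : a * expR (- (- ln a * w + ln a)) = expR (- (- ln a * w)).
    by rewrite -{1}e2 -expRD; congr expR; ring.
  have e3 : a * expR (- ln a * w) = expR (- ln a * (w - 1)).
    by rewrite -{1}e2 -expRD; congr expR; ring.
  by rewrite e1 expRD -e3; ring.
have cvgI : (\int[mu]_w critical_kernel a w)%R @[a --> 0^'+] -->
    (\int[mu]_w (\1_(`]0, 1[%classic) w : R))%R.
  apply: (@Rdominated_cvg_at_right _ _ R mu critical_kernel _
    (fun w => expR 1 * expR (- (1 * `|w|)))).
  - by move=> a; apply: continuous_measurable_fun; exact: continuous_critical_kernel.
  - exact: measurable_indic.
  - exists ([set 0] `|` [set 1]); split.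
    + exact: measurableU.
    + apply/measure_negligible; first exact: measurableU.
      apply: negligibleU; apply/negligibleP => //; exact: lebesgue_measure_set1.
    + move=> w /= H; apply: contrapT => /not_orP[/eqP w0 /eqP w1].
      by apply: H; exact: critical_kernel_cvg.
  - exact: integrable_exp_decay.
  - near=> a => w; apply: critical_kernel_decay.
    near: a; exact: (cvgryPge _).1 cvg_opp_ln 1.
have I1 : (\int[mu]_w (\1_(`]0, 1[%classic) w : R))%R = 1.
  rewrite /Rintegral integral_indic//= setIT lebesgue_measure_itv /= lte_fin ltr01.
  by rewrite -EFinD /= subr0.
rewrite I1 in cvgI; apply: cvg_trans cvgI; apply: near_eq_cvg.
near=> a; rewrite E//; near: a; exact: (cvgryPge _).1 cvg_opp_ln 1.
Unshelve. all: by end_near. Qed.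

End matern_critical.

(** * The Matern kernel as a ratio of gamma integrals *)

Section bessel.
Variable R : realType.
Local Notation mu := lebesgue_measure.

(** The integrand is even, so that the integral is half of the one over the
    line, where cosh (nu t) may be replaced by e^(nu t) by the reflection
    t |-> - t; the translation t = u - ln (z / 2) then yields the gamma
    integral. *)
Lemma besselKE (nu z : R) : 0 < nu -> 0 < z ->
  besselK nu z = (z / 2) `^ (- nu) * gamma_integral nu (z ^+ 2 / 4) / 2.
Proof.
move=> nu0 z0; have z20 : 0 < z / 2 by rewrite divr_gt0.
have z2_ge0 := ltW z20.
pose h t := expR (- z * cosh t) * cosh (nu * t).
pose e := gamma_kernel nu (z / 2) (z / 2).
have ch : continuous h.
  have ccosh : continuous (@cosh R).
    move=> t; apply: cvgMl; apply: cvgD; first exact: continuous_expR.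
    by apply: cvg_expR_comp; exact: cvgN.
  move=> t; apply: cvgM; first by apply: cvg_expR_comp; apply: cvgMr; exact: ccosh.
  by apply: (@continuous_comp _ _ _ (fun t => nu * t) (@cosh R)); [exact: cvgMr|exact: ccosh].
have h_ge0 t : 0 <= h t.
  by rewrite mulr_ge0 ?expR_ge0// /cosh divr_ge0// addr_ge0 ?expR_ge0.
have inte : mu.-integrable [set: R] (EFin \o e) by exact: integrable_gamma_kernel.
have inteN : mu.-integrable [set: R] (EFin \o (e \o -%R)).
  apply: (@exp_decay_integrable _ _ (expR (2 * nu ^+ 2 / (z / 2))) nu) => //.
    by move=> t; apply: continuous_comp; [exact: oppr_continuous|exact: continuous_gamma_kernel].
  by move=> t; rewrite -(normrN t) /=; exact: gamma_kernel_decay.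
have hE t : h t = 2^-1 * (e t + e (- t)).
  rewrite /h /e /gamma_kernel opprK /cosh mulrN.
  have -> : expR (nu * t - z / 2 * expR t - z / 2 * expR (- t)) =
    expR (- z * ((expR t + expR (- t)) / 2)) * expR (nu * t).
    by rewrite -expRD; congr expR; field.
  have -> : expR (- (nu * t) - z / 2 * expR (- t) - z / 2 * expR t) =
    expR (- z * ((expR t + expR (- t)) / 2)) * expR (- (nu * t)).
    by rewrite -expRD; congr expR; field.
  by field.
have inth : mu.-integrable [set: R] (EFin \o h).
  have := integrableZl measurableT 2^-1 (integrableD measurableT inte inteN).
  by apply: eq_integrable => // t _ /=; rewrite hE.
have -> : besselK nu z = (\int[mu]_t h t)%R / 2.
  rewrite /Rintegral (ge0_symfun_integralT h_ge0 ch); last first.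
    by move=> t; rewrite /= /h /cosh mulrN !opprK (addrC (expR (- t))) (addrC (expR (- (nu * t)))).
  rewrite -set_itvcy fineM//; last first.
    by apply: integrable_fin_num => //; apply: integrableS inth.
  by rewrite /= mulrAC mulfV// mul1r.
congr (_ / _); transitivity (\int[mu]_t e t)%R.
  under eq_Rintegral do rewrite hE.
  rewrite RintegralZl//; last exact: (integrableD measurableT inte inteN).
  rewrite RintegralD// Rintegral_oppr//; last exact: continuous_gamma_kernel.
  by field.
rewrite /gamma_integral -RintegralZl//; last first.
  by apply: integrable_gamma_kernel => //; rewrite divr_ge0 ?sqr_ge0.
rewrite -(@Rintegral_affine _ e 1 (- ln (z / 2)))//; last 2 first.
  exact: continuous_gamma_kernel.
  by move=> t; exact: gamma_kernel_ge0.
apply: eq_Rintegral => t _; rewrite mulr1 mul1r /e /gamma_kernel /powR gt_eqF//.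
rewrite -expRD; congr expR; rewrite opprD opprK !expRD expRN lnK ?posrE//.
field; exact: lt0r_neq0.
Qed.

Lemma Gamma_gt0E (nu : R) : 0 < nu -> Gamma nu = euler_integral nu.
Proof. by move=> nu0; rewrite /Gamma nu0 /= big_ord0 addr0 divr1. Qed.

Lemma Gamma_oppE (nu : R) : 0 < nu < 1 -> Gamma (- nu) = - stable_const nu.
Proof.
move=> nu01; have [nu0 nu1] := andP nu01.
rewrite /Gamma oppr_gt0 ltNge ltW// opprK /=.
have -> : Num.truncn nu = 0%N. 
  have /andP[h _] := truncn_itv (ltW nu0).
  by apply/eqP; rewrite -leqn0 -ltnS -(ltr_nat R) (le_lt_trans h).
rewrite big_ord_recl big_ord0 mulr1 addr0 addrC -stable_const_gamma//.
by field; exact: lt0r_neq0.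
Qed.

Lemma matern_kernelE (nu t : R) : 0 < nu -> 0 < t ->
  kernel_pos (Matern nu) t = gamma_integral nu (nu * t ^+ 2) / euler_integral nu.
Proof.
move=> nu0 t0 /=; have s0 : 0 < Num.sqrt nu by rewrite sqrtr_gt0.
have z0 : 0 < 2 * Num.sqrt nu * t by rewrite !mulr_gt0.
have z20 : 0 < 2 * Num.sqrt nu * t / 2 by rewrite divr_gt0.
rewrite besselKE// Gamma_gt0E//.
have -> : (2 * Num.sqrt nu * t) ^+ 2 / 4 = nu * t ^+ 2.
  by rewrite -[in RHS](sqr_sqrtr (ltW nu0)); field.
have e2 : (2 * Num.sqrt nu * t) `^ nu = 2 `^ nu * (2 * Num.sqrt nu * t / 2) `^ nu.
  by rewrite -powRM ?ltW//; congr (_ `^ _); field.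
have e3 : 2 `^ (1 - nu) * 2 `^ nu = 2 :> R.
  by rewrite -powRD ?subrK ?powRr1// implybE pnatr_eq0 orbT.
rewrite e2 powRN; set p := (_ / 2) `^ nu.
have p0 : p != 0 by rewrite gt_eqF ?powR_gt0.
have g0 : euler_integral nu != 0 by rewrite gt_eqF ?euler_integral_gt0.
transitivity ((euler_integral nu)^-1 * (2 `^ (1 - nu) * 2 `^ nu) * (p * p^-1) *
  gamma_integral nu (nu * t ^+ 2) / 2); first by ring.
by rewrite e3 mulfV//; field.
Qed.

End bessel.

(** * Expansions of the kernels at the origin *)

Section kernel_expansions.
Variable R : realType.
Local Notation mu := lebesgue_measure.
Implicit Types (d t theta : R).

Lemma euler_integral1 : euler_integral 1 = 1 :> R.
Proof.
rewrite /euler_integral /Rintegral.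
rewrite integral_itv_obnd_cbnd; last first.
  apply/measurable_EFinP; apply: measurable_funTS; apply: measurable_funM.
    by rewrite subrr; under eq_fun do rewrite powRr0; exact: measurable_cst.
  apply: continuous_measurable_fun => t.
  by apply: cvg_expR_comp; exact: cvgN.
under eq_integral do rewrite subrr powRr0 mul1r.
have dF (x : R) : is_derive x 1 (fun t => -1 * expR (-1 * t)) (expR (- x)).
  have d := is_deriveZ (-1) (is_derive_expR_comp (is_derive_scale (-1) x)).
  by apply: is_derive_eq d _; rewrite /GRing.scale /= !mulN1r mulrN1 opprK.
rewrite (@ge0_continuous_FTC2y _ _ (fun t => -1 * expR (-1 * t)) _ 0).
- by rewrite mulr0 expR0 mulr1 /= sub0r opprK.
- by move=> *; exact: expR_ge0.
- by apply: continuous_subspaceT => x; apply: cvg_expR_comp; exact: cvgN.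
- rewrite -(mulr0 (-1)); apply: cvgMr; under eq_fun do rewrite mulN1r.
  exact: cvgr_expR.
- by move=> x _; have [] := dF x.
- have cF : {for 0, continuous (fun t => -1 * expR (-1 * t))}.
    by apply/differentiable_continuous/derivable1_diffP; have [] := dF 0.
  exact: cvg_at_right_filter.
- by move=> x _; rewrite derive1E; have [] := dF x.
Qed.

Lemma cvgr_lny : ln theta @[theta --> +oo] --> (+oo : set_system R).
Proof.
apply/cvgryPge => A; near=> t.
have t_gt0 : 0 < t by near: t; apply: nbhs_pinfty_gt; exact: num_real.
by rewrite -ler_expR lnK ?posrE.
Unshelve. all: by end_near. Qed.

Lemma cvg_at_right0 (T : Type) (F : set_system T) (FF : Filter F) (f : T -> R) :
  f t @[t --> F] --> 0 -> (\forall t \near F, 0 < f t) -> f t @[t --> F] --> 0^'+.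
Proof.
move=> f0 f_gt0 P; rewrite /at_right /within /= => nP.
have H : \forall t \near F, 0 < f t -> P (f t) := f0 _ nP.
by apply: filterS2 H f_gt0 => t; apply.
Qed.

Lemma cvg_scale_inv_right d : 0 < d -> d / theta @[theta --> +oo] --> 0^'+.
Proof.
move=> d0; apply: cvg_at_right0.
  rewrite -[X in _ --> X](mulr0 d); apply: cvgMr.
  apply/(gtr0_cvgV0 (f := id)); last exact: cvg_id.
  by apply: nbhs_pinfty_gt; exact: num_real.
near=> t; rewrite divr_gt0//.
Unshelve. all: by end_near. Qed.

Lemma cvg_sqr_scale_right (nu : R) : 0 < nu -> nu * t ^+ 2 @[t --> 0^'+] --> 0^'+.
Proof.
move=> nu0; apply: cvg_at_right0.
  have h : nu * t ^+ 2 @[t --> (0 : R)^'+] --> nu * 0 ^+ 2.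
    by apply: cvg_at_right_filter; apply: cvgMr; apply: cvgM; exact: cvg_id.
  by rewrite expr0n mulr0 in h.
by near=> t; rewrite mulr_gt0// exprn_gt0.
Unshelve. all: by end_near. Qed.

Lemma powR2 t : 0 <= t -> t `^ 2 = t ^+ 2.
Proof. by move=> t0; rewrite -powR_mulrn. Qed.

(** The limit of (K(t) - 1) / t^(2q) as t --> 0+; the value is meaningless for
    the Matern kernel with nu = 1, whose expansion has a logarithm. *)
Definition leading_coef (k : corr_kernel R) : R :=
  match k with
  | Spherical => - (3 / 2)
  | PowerExponential _ => -1
  | RationalQuadratic nu => - nu
  | Matern nu =>
      if nu < 1 then Gamma (- nu) * nu `^ nu * (Gamma nu)^-1
      else - nu * (nu - 1)^-1
  end.

Lemma spherical_expansion :
  (kernel_pos Spherical t - 1) / t `^ (2 * qexp (@Spherical R)) @[t --> 0^'+]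
    --> leading_coef Spherical.
Proof.
have h : - (3 / 2) + 1 / 2 * t ^+ 2 @[t --> 0^'+] --> - (3 / 2) + 1 / 2 * (0 : R) ^+ 2.
  apply: cvg_at_right_filter; apply: cvgD; first exact: cvg_cst.
  by apply: cvgMr; apply: cvgM; exact: cvg_id.
rewrite expr0n mulr0 addr0 in h; apply: cvg_trans h; apply: near_eq_cvg.
near=> t; have t0 : 0 < t by [].
have t1 : t <= 1 by near: t; exact: nbhs_right_le.
rewrite /= t1 (_ : 2 * (1 / 2) = 1 :> R); last by field.
by rewrite powRr1 ?ltW//; field; exact: lt0r_neq0.
Unshelve. all: by end_near. Qed.

Lemma cvg_onem_expRN_div (T : Type) (F : set_system T) (FF : Filter F) (u : T -> R) :
  u t @[t --> F] --> 0^'+ -> (1 - expR (- u t)) / u t @[t --> F] --> (1 : R).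
Proof.
move=> u0.
have : (1 - expR (- s)) / s @[s --> 0^'+] --> (1 : R).
  apply: (squeeze_cvgr (f := fun s => expR (- s)) _ _ (cvg_cst _)).
    near=> s; have s0 : 0 < s by [].
    by rewrite ler_pdivlMr// ler_pdivrMr// mul1r mulrC onem_expRN_ge onem_expRN_le.
  by apply: cvg_expRN_0; exact: cvg_at_right_filter cvg_id.
exact: cvg_comp u0.
Unshelve. all: by end_near. Qed.

Lemma power_exponential_expansion (rho : R) : 0 < rho ->
  (kernel_pos (PowerExponential rho) t - 1)
    / t `^ (2 * qexp (PowerExponential rho)) @[t --> 0^'+]
    --> leading_coef (PowerExponential rho).
Proof.
move=> rho0 /=; rewrite mulrC divfK//.
have u0 : t `^ rho @[t --> 0^'+] --> 0^'+.
  apply: cvg_at_right0; first exact: powR_cvg0.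
  by near=> t; exact: powR_gt0.
apply: cvg_trans (cvgN (cvg_onem_expRN_div _ u0)); apply: near_eq_cvg.
by near=> t; rewrite -mulNr opprB.
Unshelve. all: by end_near. Qed.

Lemma rational_quadratic_expansion (nu : R) : 0 < nu ->
  (kernel_pos (RationalQuadratic nu) t - 1)
    / t `^ (2 * qexp (RationalQuadratic nu)) @[t --> 0^'+]
    --> leading_coef (RationalQuadratic nu).
Proof.
move=> nu0 /=; rewrite mulr1.
have sq0 := cvg_sqr_scale_right ltr01.
have h : (1 - (1 + u) `^ (- nu)) / u @[u --> 0^'+] --> nu.
  (* The lower bound combines 1 - e^(-y) >= y e^(-y) at y = nu ln (1 + u) with
     u e^(-u) <= ln (1 + u) <= u. *)
  apply: (squeeze_cvgr (f := fun u => nu * expR (- (u * (1 + nu)))) _ _ (cvg_cst _)).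
    near=> u; have u0 : 0 < u by [].
    have u1 : 0 < 1 + u by rewrite addr_gt0.
    have pE : (1 + u) `^ (- nu) = expR (- (nu * ln (1 + u))).
      by rewrite /powR gt_eqF// mulNr.
    have lnu : ln (1 + u) <= u by apply: le_ln1Dx; rewrite (lt_trans _ u0)// ltrN10.
    have lnu' : u * expR (- u) <= ln (1 + u).
      apply: le_trans (onem_expRN_le (ln (1 + u))).
      rewrite (expRN (ln _)) lnK ?posrE//.
      have -> : 1 - (1 + u)^-1 = u / (1 + u) by field; exact: lt0r_neq0.
      by rewrite ler_pM2l// expRN lef_pV2 ?posrE ?expR_gt0// expR_ge1Dx.
    rewrite pE ler_pdivlMr// ler_pdivrMr//; apply/andP; split; last first.
      by rewrite (le_trans (onem_expRN_le _))// ler_pM2l.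
    apply: le_trans (onem_expRN_ge _).
    rewrite mulrDr mulr1 opprD expRD.
    have -> : nu * (expR (- u) * expR (- (u * nu))) * u =
      nu * (u * expR (- u)) * expR (- (nu * u)) by rewrite (mulrC u nu); ring.
    apply: ler_pM; rewrite ?expR_ge0//.
    - by rewrite !mulr_ge0 ?expR_ge0// ltW.
    - by rewrite ler_pM2l.
    - by rewrite ler_expR lerN2 ler_pM2l.
  by rewrite -[X in _ --> X]mulr1; apply: cvgMr; exact: cvg_expRN_scale.
apply: cvg_trans (cvgN (cvg_comp _ _ sq0 h)); apply: near_eq_cvg.
near=> t; have t0 : 0 < t by [].
by rewrite !fctE /= mul1r -mulNr opprB powR2 ?ltW.
Unshelve. all: by end_near. Qed.

Lemma matern_rough_expansion (nu : R) : 0 < nu < 1 ->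
  (kernel_pos (Matern nu) t - 1) / t `^ (2 * qexp (Matern nu)) @[t --> 0^'+]
    --> leading_coef (Matern nu).
Proof.
move=> nu01; have [nu0 nu1] := andP nu01; rewrite /qexp /leading_coef nu1.
have g0 : euler_integral nu != 0 by rewrite gt_eqF ?euler_integral_gt0.
have h := cvg_comp _ _ (cvg_sqr_scale_right nu0) (gamma_integral_rough nu01).
rewrite Gamma_oppE// Gamma_gt0E// -mulrA.
apply: cvg_trans (cvgM h (cvg_cst (nu `^ nu / euler_integral nu))).
apply: near_eq_cvg; near=> t; have t0 : 0 < t by [].
rewrite matern_kernelE//= powRrM powR2 ?ltW// powRM ?sqr_ge0 ?ltW//.
have n1 : nu `^ nu != 0 by rewrite gt_eqF ?powR_gt0.
have n2 : (t ^+ 2) `^ nu != 0 by rewrite gt_eqF ?powR_gt0 ?exprn_gt0.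
by field; rewrite n1 n2 g0.
Unshelve. all: by end_near. Qed.

Lemma matern_smooth_expansion (nu : R) : 1 < nu ->
  (kernel_pos (Matern nu) t - 1) / t `^ (2 * qexp (Matern nu)) @[t --> 0^'+]
    --> leading_coef (Matern nu).
Proof.
move=> nu1; have nu0 : 0 < nu by rewrite (lt_trans ltr01).
have nu10 : 0 < nu - 1 by rewrite subr_gt0.
rewrite /qexp /leading_coef ltNge (ltW nu1) [in 2 * _]/= mulr1.
have g0 : euler_integral nu != 0 by rewrite gt_eqF ?euler_integral_gt0.
have h := cvg_comp _ _ (cvg_sqr_scale_right nu0) (gamma_integral_smooth nu1).
have -> : - nu / (nu - 1) = - euler_integral (nu - 1) * (nu / euler_integral nu).
  rewrite -[in RHS](subrK 1 nu) euler_integralS// subrK.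
  have g1 : euler_integral (nu - 1) != 0 by rewrite gt_eqF ?euler_integral_gt0.
  by field; rewrite g1 gt_eqF.
apply: cvg_trans (cvgM h (cvg_cst (nu / euler_integral nu))).
apply: near_eq_cvg; near=> t; have t0 : 0 < t by [].
rewrite matern_kernelE//= powR2 ?ltW//.
by field; rewrite g0 !lt0r_neq0.
Unshelve. all: by end_near. Qed.

Lemma ratio_of_expansion (k : corr_kernel R) d :
  0 < d -> leading_coef k != 0 ->
  (forall theta, 0 < theta ->
     g0 k theta = leading_coef k * theta `^ (- (2 * qexp k))) ->
  (kernel_pos k t - 1) / t `^ (2 * qexp k) @[t --> 0^'+] --> leading_coef k ->
  (kernel_pos k (d / theta) - 1) / g0 k theta @[theta --> +oo]
    --> d `^ (2 * qexp k).
Proof.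
move=> d0 c0 gE h.
have h1 := cvg_comp _ _ (cvg_scale_inv_right d0) h.
have -> : d `^ (2 * qexp k) = leading_coef k * (d `^ (2 * qexp k) / leading_coef k).
  by field.
apply: cvg_trans (cvgM h1 (cvg_cst (d `^ (2 * qexp k) / leading_coef k))).
apply: near_eq_cvg; near=> theta.
have th0 : 0 < theta by near: theta; apply: nbhs_pinfty_gt; exact: num_real.
have tE : (d / theta) `^ (2 * qexp k) = d `^ (2 * qexp k) / theta `^ (2 * qexp k).
  by rewrite powRM ?invr_ge0 ?ltW// -powR_inv1 ?ltW// -powRrM mulN1r powRN.
rewrite /= gE// powRN tE.
have n1 : d `^ (2 * qexp k) != 0 by rewrite gt_eqF ?powR_gt0.
have n2 : theta `^ (2 * qexp k) != 0 by rewrite gt_eqF ?powR_gt0.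
by field; rewrite n1 n2 c0.
Unshelve. all: by end_near. Qed.

(** Here a = (d / theta)^2, and a ln a = 2 d^2 theta^(-2) (ln d - ln theta)
    is equivalent to d^2 g0(theta), since ln d / ln theta --> 0. *)
Lemma matern_critical_ratio d : 0 < d ->
  (kernel_pos (Matern 1) (d / theta) - 1) / g0 (Matern 1) theta @[theta --> +oo]
    --> d `^ (2 * qexp (Matern (1 : R))).
Proof.
move=> d0; rewrite /qexp /g0 ltxx eqxx mulr1 powR2 ?ltW//.
have h := cvg_comp _ _ (cvg_scale_inv_right d0)
  (cvg_comp _ _ (cvg_sqr_scale_right ltr01) (@gamma_integral_critical R)).
have l0 : (ln theta)^-1 @[theta --> +oo] --> (0 : R).
  apply/(gtr0_cvgV0 (f := @ln R)); last exact: cvgr_lny.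
  near=> t; apply: ln_gt0; near: t; apply: nbhs_pinfty_gt; exact: num_real.
have hl : d ^+ 2 * (1 - ln d / ln theta) @[theta --> +oo] --> d ^+ 2 * (1 - ln d * 0).
  by apply: cvgMr; apply: cvgB; [exact: cvg_cst|exact: cvgMr].
rewrite [X in _ --> X](_ : _ = 1 * (d ^+ 2 * (1 - ln d * 0))); last first.
  by rewrite mulr0 subr0 mulr1 mul1r.
apply: cvg_trans (cvgM h hl); apply: near_eq_cvg; near=> theta.
have th0 : 0 < theta by near: theta; apply: nbhs_pinfty_gt; exact: num_real.
have lnth0 : ln theta != 0.
  rewrite gt_eqF// ln_gt0//; near: theta; apply: nbhs_pinfty_gt; exact: num_real.
have dth0 : 0 < d / theta by rewrite divr_gt0.
have lna0 : ln ((d / theta) ^+ 2) != 0.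
  rewrite lt_eqF// ln_lt0// exprn_gt0//= exprn_ilt1 ?ltW//.
  rewrite ltr_pdivrMr// mul1r; near: theta; apply: nbhs_pinfty_gt; exact: num_real.
rewrite matern_kernelE// !fctE /= !mul1r euler_integral1 divr1.
have lnE : ln ((d / theta) ^+ 2) = 2 * (ln d - ln theta).
  by rewrite lnXn// ln_div ?posrE// mulr_natl.
have lnd0 : ln d - ln theta != 0.
  by apply: contra_neq lna0; rewrite lnE => ->; rewrite mulr0.
rewrite lnE; field; rewrite lnd0 lnth0 !lt0r_neq0//.
Unshelve. all: by end_near. Qed.

Lemma leading_coef_neq0 (r : nat) (k : corr_kernel R) :
  kernel_admissible r k -> k <> Matern 1 -> leading_coef k != 0.
Proof.
case: k => [_|rho _|nu nu0|nu nu0] /=.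
- by rewrite oppr_eq0 mulf_neq0.
- by rewrite oppr_eq0 oner_eq0.
- by rewrite oppr_eq0 gt_eqF.
- move=> nu_ne; rewrite [kernel_admissible _ _]/= in nu0.
  case: ltgtP nu_ne => [nu1 _|nu1 _|-> //].
    have C0 : 0 < stable_const nu.
      rewrite -(pmulr_rgt0 _ nu0) stable_const_gamma ?nu0//.
      by rewrite euler_integral_gt0// subr_gt0.
    rewrite Gamma_oppE ?nu0// Gamma_gt0E// !mulf_neq0 ?invr_eq0 ?oppr_eq0//.
    - by rewrite gt_eqF.
    - by rewrite gt_eqF ?powR_gt0.
    - by rewrite gt_eqF ?euler_integral_gt0.
  by rewrite mulf_neq0 ?invr_eq0 ?oppr_eq0// gt_eqF// subr_gt0.
Qed.

Lemma g0E (r : nat) (k : corr_kernel R) (theta : R) :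
  kernel_admissible r k -> k <> Matern 1 -> 0 < theta ->
  g0 k theta = leading_coef k * theta `^ (- (2 * qexp k)).
Proof.
move=> adm kne th0; case: k adm kne => [_ _|rho _ _|nu _ _|nu nu0 nu_ne] /=.
- by rewrite (_ : 2 * (1 / 2) = 1 :> R) ?powR_inv1 ?ltW//; field.
- by rewrite mulN1r (_ : 2 * (rho / 2) = rho)//; field.
- by rewrite mulr1 powRN powR2// ltW.
- case: ltgtP nu_ne => [nu1 _|nu1 _|-> //]; first by [].
  by rewrite mulr1 powRN powR2// ltW.
Qed.

Lemma kernel_ratio_cvg (r : nat) (k : corr_kernel R) d :
  kernel_admissible r k -> 0 < d ->
  (kernel_pos k (d / theta) - 1) / g0 k theta @[theta --> +oo]
    --> d `^ (2 * qexp k).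
Proof.
move=> adm d0; have [->|kne] := pselect (k = Matern 1).
  exact: matern_critical_ratio.
apply: ratio_of_expansion => //.
- exact: leading_coef_neq0 adm kne.
- by move=> theta; exact: g0E adm kne.
case: k adm kne => [_ _|rho /andP[rho0 _] _|nu nu0 _|nu nu0 nu_ne].
- exact: spherical_expansion.
- exact: power_exponential_expansion.
- exact: rational_quadratic_expansion.
- rewrite /= in nu0; have [nu1|nu1|nu1] := ltgtP nu 1.
  + by apply: matern_rough_expansion; rewrite nu0.
  + exact: matern_smooth_expansion.
  + by rewrite nu1 in nu_ne.
Qed.

Lemma g0_neq0 (r : nat) (k : corr_kernel R) :
  kernel_admissible r k -> \forall theta \near +oo, g0 k theta != 0.
Proof.
move=> adm; near=> theta.
have th1 : 1 < theta by near: theta; apply: nbhs_pinfty_gt; exact: num_real.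
have th0 : 0 < theta by rewrite (lt_trans ltr01).
have [->|kne] := pselect (k = Matern 1).
  rewrite /= ltxx eqxx !mulf_neq0 ?oppr_eq0 ?invr_eq0 ?expf_neq0 ?gt_eqF//.
  exact: ln_gt0.
by rewrite (g0E adm kne th0) mulf_neq0 ?(leading_coef_neq0 adm kne)// gt_eqF ?powR_gt0.
Unshelve. all: by end_near. Qed.

End kernel_expansions.

(** * Distance matrices and the decomposition *)

Section dist_matrices.
Variables (R : realType) (n r : nat) (x : 'I_n -> 'rV[R]_r).

Lemma euclid_norm_powR (u v : 'rV[R]_r) (q : R) :
  euclid_norm (u - v) `^ (2 * q) = sqdist u v `^ q.
Proof. by rewrite powRrM powR2 ?sqrtr_ge0// sqr_sqrtr ?sqdist_ge0. Qed.

Lemma euclid_norm_gt0 (u v : 'rV[R]_r) : u != v -> 0 < euclid_norm (u - v).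
Proof. by move=> uv; rewrite sqrtr_gt0; exact: sqdist_gt0. Qed.

Lemma dist_matrix_unitmx (q : R) :
  injective x -> 0 < q < 1 -> (1 < n)%N -> dist_matrix x q \in unitmx.
Proof.
move=> x_inj q01 n_gt1; have q_neq0 : q != 0 by rewrite gt_eqF//; case/andP: q01.
pose i0 := Ordinal (ltnW n_gt1); pose i1 := Ordinal n_gt1.
apply: (@cond_neg_def_unitmx _ _ _ i0 i1).
- by apply/matrixP => i j; rewrite !mxE !euclid_norm_powR sqdistC.
- by rewrite mxE euclid_norm_powR sqdistxx powR0.
- by rewrite mxE euclid_norm_powR sqdistxx powR0.
- rewrite mxE euclid_norm_powR powR_gt0// sqdist_gt0//.
  by apply/eqP => /x_inj /(congr1 val).
- move=> c c_neq0 sum_c; rewrite quad_formE.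
  under eq_bigr do under eq_bigr do rewrite mxE euclid_norm_powR.
  by apply: (sqdist_power_cond_neg (c := fun i => c 0 i)) => //; apply/rV0Pn.
Qed.

Lemma dist_matrix1_notin_unitmx : (r + 2 < n)%N -> dist_matrix x 1 \notin unitmx.
Proof.
move=> rn; rewrite (_ : dist_matrix x 1 = \matrix_(i, j) sqdist (x i) (x j)).
  exact: sqdist_matrix_notin_unitmx.
by apply/matrixP => i j; rewrite !mxE euclid_norm_powR powRr1 ?sqdist_ge0.
Qed.

End dist_matrices.

Lemma cvg_frobenius_norm0 (R : realType) (m n : nat) (T : Type) (F : set_system T)
    (FF : Filter F) (M : T -> 'M[R]_(m, n)) :
  (forall i j, M t i j @[t --> F] --> 0) -> frobenius_norm (M t) @[t --> F] --> 0.
Proof.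
move=> M0; rewrite /frobenius_norm -[X in _ --> X]sqrtr0.
apply: continuous_cvg; first exact: sqrt_continuous.
rewrite [X in _ --> X](_ : 0 = \sum_(i < m) \sum_(j < n) (0 : R) ^+ 2); last first.
  by rewrite big1// => i _; rewrite big1// => j _; rewrite expr0n.
apply: cvg_sum_fin => i; apply: cvg_sum_fin => j.
by apply: (cvgM (M0 i j) (M0 i j)).
Qed.

Lemma rough_kernel_qexp (R : realType) (r : nat) (k : corr_kernel R) :
  kernel_admissible r k -> rough_kernel k -> 0 < qexp k < 1.
Proof.
case: k => [|rho|nu|nu] //=.
- by move=> _ _; apply/andP; split; lra.
- by move=> /andP[rho0 _] rho2; apply/andP; split; lra.
- by move=> nu0 nu1; rewrite nu1 nu0.
Qed.

Lemma smooth_kernel_qexp (R : realType) (k : corr_kernel R) :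
  smooth_kernel k -> qexp k = 1.
Proof.
case: k => [//|rho /eqP ->|//|nu /=]; first by rewrite /= divrr// unitfE.
by rewrite leNgt => /negbTE ->.
Qed.

Lemma qexp_gt0 (R : realType) (r : nat) (k : corr_kernel R) :
  kernel_admissible r k -> 0 < qexp k.
Proof.
case: k => [|rho|nu|nu] //=.
- by move=> /andP[rho0 _]; lra.
- by case: ifP.
Qed.

Unset Implicit Arguments.

(* The nonsingularity claim needs n >= 2: for n = 1 the matrix is the zero
   1 x 1 matrix. *)
Theorem proposition3p4 (R : realType) (n r : nat)
    (n_gt0 : (0 < n)%N) (r_gt0 : (0 < r)%N)
    (x : 'I_n -> 'rV[R]_r) (x_distinct : injective x)
    (k : corr_kernel R) (k_adm : kernel_admissible r k) :
  exists R0 : R -> 'M[R]_n,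
    [/\ (forall theta : R, 0 < theta ->
           corr_matrix x k theta =
             ones R n *m (ones R n)^T + g0 k theta *: dist_matrix x (qexp k)
             + R0 theta)
        /\ frobenius_norm ((g0 k theta)^-1 *: R0 theta)
             @[theta --> +oo] --> (0 : R),
        (rough_kernel k ->
           qexp k < 1 /\ ((1 < n)%N -> dist_matrix x (qexp k) \in unitmx)),
        (smooth_kernel k -> qexp k = 1)
      & ((r + 2 < n)%N -> smooth_kernel k ->
           dist_matrix x (qexp k) = dist_matrix x 1
           /\ dist_matrix x (qexp k) \notin unitmx) ].
Proof.
exists (fun theta => corr_matrix x k theta -
  (ones R n *m (ones R n)^T + g0 k theta *: dist_matrix x (qexp k))).
split; [split|..].
- by move=> theta _; rewrite addrC subrK.
- apply: cvg_frobenius_norm0 => i j.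
  have [->|ij] := eqVneq i j.
    under eq_cvg => theta.
      rewrite !mxE big_ord1 !mxE mulr1 euclid_norm_powR sqdistxx powR0; last first.
        by rewrite gt_eqF// (qexp_gt0 k_adm).
      rewrite subrr /kernel_fun /euclid_norm.
      rewrite big1 ?sqrtr0 ?mul0r ?eqxx; last first.
        by move=> l _; rewrite mxE expr0n.
      rewrite mulr0 addr0 subrr mulr0.
      over.
    exact: cvg_cst.
  have d0 : 0 < euclid_norm (x i - x j).
    by apply: euclid_norm_gt0; apply: contra_neq ij; exact: x_distinct.
  rewrite -[X in _ --> X](subrr (euclid_norm (x i - x j) `^ (2 * qexp k))).
  apply: cvg_trans (cvgB (kernel_ratio_cvg k_adm d0) (cvg_cst _)).
  apply: near_eq_cvg; near=> theta.
  have th0 : 0 < theta by near: theta; apply: nbhs_pinfty_gt; exact: num_real.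
  have g00 : g0 k theta != 0 by near: theta; exact: g0_neq0 k_adm.
  rewrite !mxE big_ord1 !mxE mulr1 /kernel_fun gt_eqF ?divr_gt0// !fctE /=.
  by field.
- move=> k_rough; have q01 := rough_kernel_qexp k_adm k_rough.
  by split; [case/andP: q01|exact: dist_matrix_unitmx].
- exact: smooth_kernel_qexp.
- move=> rn k_smooth; rewrite smooth_kernel_qexp//; split=> //.
  exact: dist_matrix1_notin_unitmx.
Unshelve. all: by end_near. Qed.
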